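(* Let $(M,g)$ be a $4$-dimensional spacetime threaded by a (not necessarily normalized) timelike vector field $\xi=\partial/\partial x^0$, with the notation of the context (the spatial distribution $SM$ is not assumed integrable). The curvature tensor field $\bar R$ of the Riemannian spatial connection $\bar\nabla$ satisfies the following identities, called the Bianchi identities for the Riemannian spatial connection, for all values in $\{1,2,3\}$ of the free indices: $$\sum_{(i,j,k)}\big\{\bar R_{i\ jk}^{\ h}+2K^h_i\omega_{jk}\big\}=0,$$ $$\sum_{(i,j,k)}\big\{\bar R_{h\ ij|k}^{\ l}+\bar R_{h\ 0i|k}^{\ l}\,\omega_{jk}\big\}=0,$$ $$\bar R_{h\ ij|0}^{\ l}+\bar R_{h\ 0i|j}^{\ l}-\bar R_{h\ 0j|i}^{\ l}+\bar R_{h\ ik}^{\ l}K^k_j-\bar R_{h\ jk}^{\ l}K^k_i+a_j\bar R_{h\ 0i}^{\ l}-a_i\bar R_{h\ 0j}^{\ l}=0,$$ where $\sum_{(i,j,k)}$ denotes the cyclic sum with respect to $(i,j,k)$ (in the first two identities $i,j,k$ are subject only to this cyclic sum), and in the last identity $k$ is summed.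
   Context: Indices $h,i,j,k,l$ run over $\{1,2,3\}$; the summation convention is used for an index repeated once up and once down. $(M,g)$ is a $4$-dimensional spacetime with Lorentz metric of signature $(-,+,+,+)$ and Levi-Civita connection $\nabla$. $\xi$ is a timelike vector field; $TM=VM\oplus SM$, where $VM$ is spanned by $\xi$ and the spatial distribution $SM$ is its orthogonal complement; $\mathcal S$ denotes the projection onto $SM$. Local coordinates $(x^0,x^i)$ are chosen with $\xi=\partial/\partial x^0$. Put $g(\partial_{x^0},\partial_{x^0})=-\Phi^2$ with $\Phi$ a nowhere zero function, $\xi_i=g(\partial_{x^i},\partial_{x^0})$, $A_i=-\Phi^{-2}\xi_i$, and $\frac{\delta}{\delta x^i}=\frac{\partial}{\partial x^i}-A_i\frac{\partial}{\partial x^0}$ (a local frame of $SM$). Define $$\omega_{ij}=\tfrac12\Big(\frac{\delta A_j}{\delta x^i}-\frac{\delta A_i}{\delta x^j}\Big),\quad a_i=-\frac{\partial A_i}{\partial x^0},\quad \bar g_{ij}=g\Big(\frac{\delta}{\delta x^i},\frac{\delta}{\delta x^j}\Big),\quad \Theta_{ij}=\tfrac12\frac{\partial\bar g_{ij}}{\partial x^0},$$ $K_{ij}=\Theta_{ij}+\Phi^2\omega_{ij}$ and $K^k_j=\bar g^{ki}K_{ij}$ (first index raised). The Riemannian spatial connection is the metric connection on $SM$ given by $\bar\nabla_X\mathcal SY=\mathcal S\nabla_X\mathcal SY$; locally $\bar\nabla_{\delta/\delta x^j}\frac{\delta}{\delta x^i}=\bar\Gamma^{\ k}_{i\ j}\frac{\delta}{\delta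 x^k}$ and $\bar\nabla_{\partial/\partial x^0}\frac{\delta}{\delta x^i}=K^k_i\frac{\delta}{\delta x^k}$, with $\bar\Gamma^{\ k}_{i\ j}=\tfrac12\bar g^{kh}\big(\frac{\delta\bar g_{hj}}{\delta x^i}+\frac{\delta\bar g_{hi}}{\delta x^j}-\frac{\delta\bar g_{ij}}{\delta x^h}\big)$. Its curvature is $\bar R(X,Y,Z)=\bar\nabla_X\bar\nabla_Y\mathcal SZ-\bar\nabla_Y\bar\nabla_X\mathcal SZ-\bar\nabla_{[X,Y]}\mathcal SZ$, with components $$\bar R\Big(\frac{\delta}{\delta x^k},\frac{\delta}{\delta x^j},\frac{\delta}{\delta x^i}\Big)=\bar R_{i\ jk}^{\ h}\frac{\delta}{\delta x^h},\qquad \bar R\Big(\frac{\delta}{\delta x^k},\frac{\partial}{\partial x^0},\frac{\delta}{\delta x^i}\Big)=\bar R_{i\ 0k}^{\ h}\frac{\delta}{\delta x^h}.$$ $\bar R_{i\ jk}^{\ h}$ and $\bar R_{i\ 0k}^{\ h}$ are components of spatial tensor fields of type $(1,3)$ and $(1,2)$ (the index $0$ is not a tensor index). A vertical bar denotes the covariant derivative of spatial tensor fields induced by $\bar\nabla$: each upper index contributes $+\bar\Gamma$ (respectively $+K$) terms and each lower index $-\bar\Gamma$ (respectively $-K$) terms, e.g. $T^j_{i|k}=\frac{\delta T^j_i}{\delta x^k}+T^h_i\bar\Gamma^{\ j}_{h\ k}-T^j_h\bar\Gamma^{\ h}_{i\ k}$ and $T^j_{i|0}=\frac{\partial T^j_i}{\partial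 x^0}+T^h_iK^j_h-T^j_hK^h_i$, and similarly for other types.
   Formalization: The second identity is false as printed; the term $\bar R_{h\ 0i|k}^{\ l}\,\omega_{jk}$ is replaced by $2\bar R_{h\ 0i}^{\ l}\,\omega_{jk}$ (no covariant derivative, factor 2). *)

(* Defs.v *)
From HB Require Import structures.
From mathcomp Require Import all_boot all_order all_algebra.
From mathcomp Require Import all_classical all_reals all_analysis.
Set Implicit Arguments.
Unset Strict Implicit.
Unset Printing Implicit Defensive.
Import Order.TTheory GRing.Theory Num.Theory.
Import numFieldNormedType.Exports.
Local Open Scope classical_set_scope.
Local Open Scope ring_scope.

(* Everything is written in a chart: a point is its coordinate vector          *)
(* (x^0, x^1, x^2, x^3).  Spacetime indices are in 'I_4.  A spatial index      *)
(* i : 'I_3 = {0, 1, 2} stands for the coordinate x^(i+1), that is, for the    *)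
(* spacetime index [sp i].                                                     *)
Notation point R := 'rV[R]_4.
Notation sfun R := ('rV[R]_4 -> R).
Notation vfield R := ('rV[R]_4 -> 'rV[R]_4).
Notation sp i := (lift (ord0 : 'I_4) (i : 'I_3)).

Definition pd (R : realType) (a : 'I_4) (f : sfun R) : sfun R :=
  fun x => 'D_(delta_mx 0 a) f x.

(* C^oo: all iterated partial derivatives exist and are continuous. *)
Definition smooth_on (R : realType) (U : set (point R)) (f : sfun R) : Prop :=
  forall (s : seq 'I_4) (x : point R), U x ->
    {for x, continuous (foldr (@pd R) f s)} /\
    forall a : 'I_4, derivable (foldr (@pd R) f s) x (delta_mx 0 a).

Definition minkowski (R : realType) : 'M[R]_4 :=
  diag_mx (\row_a (if a == ord0 then -1 else 1)).

(* A symmetric bilinear form of signature (-,+,+,+): it has an orthonormal     *)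
(* basis, given by the rows of P.                                              *)
Definition lorentzian (R : realType) (G : 'M[R]_4) : Prop :=
  G^T = G /\
  exists P : 'M[R]_4, P \in unitmx /\ P *m G *m P^T = minkowski R.

Definition gprod (R : realType) (g : point R -> 'M[R]_4) (X Y : vfield R) :
    sfun R :=
  fun x => (X x *m g x *m (Y x)^T) 0 0.

Definition vder (R : realType) (X : vfield R) (f : sfun R) : sfun R :=
  fun x => \sum_a X x 0 a * pd a f x.

Definition bracket (R : realType) (X Y : vfield R) : vfield R :=
  fun x => \row_a (vder X (fun y => Y y 0 a) x - vder Y (fun y => X y 0 a) x).

(* [christoffel g c a b] has upper index c and lower indices a, b. *)
Definition christoffel (R : realType) (g : point R -> 'M[R]_4)
    (c a b : 'I_4) : sfun R :=
  fun x => 2^-1 * \sum_d invmx (g x) c d *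
    (pd a (fun y => g y d b) x + pd b (fun y => g y d a) x
     - pd d (fun y => g y a b) x).

Definition nabla (R : realType) (g : point R -> 'M[R]_4) (X Y : vfield R) :
    vfield R :=
  fun x => \row_c (vder X (fun y => Y y 0 c) x
    + \sum_a \sum_b christoffel g c a b x * X x 0 a * Y x 0 b).

Definition dcoord (R : realType) (a : 'I_4) : vfield R := fun _ => delta_mx 0 a.
Arguments dcoord R a x : clear implicits.

Definition xi (R : realType) : vfield R := dcoord R ord0.
Arguments xi R x : clear implicits.

(* The projection of TM = VM (+) SM onto SM, the orthogonal complement of xi. *)
Definition Sproj (R : realType) (g : point R -> 'M[R]_4) (X : vfield R) :
    vfield R :=
  fun x => X x - (gprod g X (xi R) x / gprod g (xi R) (xi R) x) *: xi R x.

Definition xi_low (R : realType) (g : point R -> 'M[R]_4) (i : 'I_3) : sfun R :=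
  gprod g (dcoord R (sp i)) (xi R).

Definition Acoef (R : realType) (g : point R -> 'M[R]_4) (Phi : sfun R)
    (i : 'I_3) : sfun R :=
  fun x => - (Phi x) ^- 2 * xi_low g i x.

(* delta/delta x^i *)
Definition sdelta (R : realType) (g : point R -> 'M[R]_4) (Phi : sfun R)
    (i : 'I_3) : vfield R :=
  fun x => dcoord R (sp i) x - Acoef g Phi i x *: xi R x.

Definition omega (R : realType) (g : point R -> 'M[R]_4) (Phi : sfun R)
    (i j : 'I_3) : sfun R :=
  fun x => 2^-1 * (vder (sdelta g Phi i) (Acoef g Phi j) x
                   - vder (sdelta g Phi j) (Acoef g Phi i) x).

Definition acoef (R : realType) (g : point R -> 'M[R]_4) (Phi : sfun R)
    (i : 'I_3) : sfun R :=
  fun x => - pd ord0 (Acoef g Phi i) x.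

Definition gbar (R : realType) (g : point R -> 'M[R]_4) (Phi : sfun R)
    (x : point R) : 'M[R]_3 :=
  \matrix_(i, j) gprod g (sdelta g Phi i) (sdelta g Phi j) x.

Definition Theta (R : realType) (g : point R -> 'M[R]_4) (Phi : sfun R)
    (i j : 'I_3) : sfun R :=
  fun x => 2^-1 * pd ord0 (fun y => gbar g Phi y i j) x.

Definition Klow (R : realType) (g : point R -> 'M[R]_4) (Phi : sfun R)
    (i j : 'I_3) : sfun R :=
  fun x => Theta g Phi i j x + (Phi x) ^+ 2 * omega g Phi i j x.

(* [Kmix k j] is K^k_j = gbar^{ki} K_{ij}. *)
Definition Kmix (R : realType) (g : point R -> 'M[R]_4) (Phi : sfun R)
    (k j : 'I_3) : sfun R :=
  fun x => \sum_i invmx (gbar g Phi x) k i * Klow g Phi i j x.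

(* To be applied to sections Y of SM. *)
Definition nablabar (R : realType) (g : point R -> 'M[R]_4) (X Y : vfield R) :
    vfield R :=
  Sproj g (nabla g X Y).

Definition Rbar (R : realType) (g : point R -> 'M[R]_4) (X Y Z : vfield R) :
    vfield R :=
  fun x => nablabar g X (nablabar g Y (Sproj g Z)) x
           - nablabar g Y (nablabar g X (Sproj g Z)) x
           - nablabar g (bracket X Y) (Sproj g Z) x.

(* Component along delta/delta x^h of a section of SM.  It is the coordinate   *)
(* component of index h, as delta/delta x^h - d/dx^h is a multiple of d/dx^0;  *)
(* see [Sproj_expansion].                                                      *)
Definition scomp (R : realType) (V : vfield R) (h : 'I_3) : sfun R :=
  fun x => V x 0 (sp h).

Lemma Sproj_expansion (R : realType) (g : point R -> 'M[R]_4) (Phi : sfun R)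
    (X : vfield R) (x : point R) :
  Phi x != 0 ->
  gprod g (xi R) (xi R) x = - (Phi x) ^+ 2 ->
  Sproj g X x = \sum_h scomp (Sproj g X) h x *: sdelta g Phi h x.
Proof.
move=> Phi0 g00.
have dE (Z : vfield R) : gprod g Z (xi R) x = \sum_a Z x 0 a * g x a 0.
  rewrite /gprod /xi /dcoord trmx_delta -colE !mxE.
  by [].
have P0 : \sum_a (Sproj g X) x 0 a * g x a 0 = 0.
  have n0 : gprod g (xi R) (xi R) x != 0 by rewrite g00 oppr_eq0 expf_neq0.
  have [q qE SE] : exists2 q,
      q * gprod g (xi R) (xi R) x = gprod g X (xi R) x &
      Sproj g X x = X x - q *: xi R x.
    by exists (gprod g X (xi R) x / gprod g (xi R) (xi R) x); rewrite ?divfK.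
  transitivity (gprod g X (xi R) x - q * gprod g (xi R) (xi R) x).
    rewrite SE (dE X) (dE (xi R)) mulr_sumr -sumrB; apply: eq_bigr => a _.
    by rewrite !mxE mulrBl mulrA.
  by rewrite qE subrr.
have g0E : g x ord0 0 = - (Phi x) ^+ 2.
  rewrite -g00 dE (bigD1 ord0) //= big1 ?addr0.
    by rewrite /xi /dcoord mxE !eqxx mul1r.
  by move=> a a0; rewrite /xi /dcoord mxE (negPf a0) mul0r.
have xlE h : xi_low g h x = g x (sp h) 0.
  rewrite /xi_low dE (bigD1 (sp h)) //= big1 ?addr0.
    by rewrite /dcoord mxE !eqxx mul1r.
  by move=> a a0; rewrite /dcoord mxE (negPf a0) mul0r.
have F2 : (Phi x) ^+ 2 != 0 by rewrite expf_neq0.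
rewrite /scomp; move: (Sproj g X x) P0 => v P0.
apply/rowP => a; rewrite summxE.
case: (unliftP ord0 a) => [k ->|->].
  rewrite (bigD1 k) //= big1 ?addr0.
    by rewrite /sdelta /dcoord /xi /dcoord !mxE !eqxx /= mulr0 subr0 mulr1.
  move=> h hk; rewrite /sdelta /dcoord /xi /dcoord !mxE /=.
  by rewrite (inj_eq lift_inj) eq_sym (negPf hk) !(mulr0, subr0).
move/eqP: P0; rewrite big_ord_recl g0E mulrN addrC subr_eq0 => /eqP P0.
apply: (mulIf F2); rewrite -P0 big_distrl /=; apply: eq_bigr => h _.
rewrite /sdelta /dcoord /xi /dcoord /Acoef !mxE /= mulr1 sub0r.
by rewrite mulNr opprK xlE -mulrA mulrAC mulVf // mul1r.
Qed.

(* [Rs h i j k] is R_i^h_jk, the h-component of                                *)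
(* Rbar(delta/delta x^k, delta/delta x^j, delta/delta x^i).                    *)
Definition Rs (R : realType) (g : point R -> 'M[R]_4) (Phi : sfun R)
    (h i j k : 'I_3) : sfun R :=
  scomp (Rbar g (sdelta g Phi k) (sdelta g Phi j) (sdelta g Phi i)) h.

(* [R0 h i k] is R_i^h_0k, the h-component of                                  *)
(* Rbar(delta/delta x^k, d/dx^0, delta/delta x^i).                             *)
Definition R0 (R : realType) (g : point R -> 'M[R]_4) (Phi : sfun R)
    (h i k : 'I_3) : sfun R :=
  scomp (Rbar g (sdelta g Phi k) (xi R) (sdelta g Phi i)) h.

(* [Gammabar i k j] is Gammabar_i^k_j, where                                   *)
(* nablabar_(delta/delta x^j) (delta/delta x^i)                                *)
(*   = Gammabar_i^k_j delta/delta x^k.                                         *)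
Definition Gammabar (R : realType) (g : point R -> 'M[R]_4) (Phi : sfun R)
    (i k j : 'I_3) : sfun R :=
  fun x => 2^-1 * \sum_h invmx (gbar g Phi x) k h *
    (vder (sdelta g Phi i) (fun y => gbar g Phi y h j) x
     + vder (sdelta g Phi j) (fun y => gbar g Phi y h i) x
     - vder (sdelta g Phi h) (fun y => gbar g Phi y i j) x).

(* Components of the derivative, in the direction of X, of a tensor field of   *)
(* type (1,2), T_h^l_i = T l h i, or (1,3), T_h^l_ij = T l h i j, when         *)
(* nablabar_X (delta/delta x^i) = C l i delta/delta x^l.                       *)
Definition cov12 (R : realType) (X : vfield R) (C : 'I_3 -> 'I_3 -> sfun R)
    (T : 'I_3 -> 'I_3 -> 'I_3 -> sfun R) (l h i : 'I_3) : sfun R :=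
  fun x => vder X (T l h i) x
    + \sum_m T m h i x * C l m x
    - \sum_m T l m i x * C m h x
    - \sum_m T l h m x * C m i x.

Definition cov13 (R : realType) (X : vfield R) (C : 'I_3 -> 'I_3 -> sfun R)
    (T : 'I_3 -> 'I_3 -> 'I_3 -> 'I_3 -> sfun R) (l h i j : 'I_3) : sfun R :=
  fun x => vder X (T l h i j) x
    + \sum_m T m h i j x * C l m x
    - \sum_m T l m i j x * C m h x
    - \sum_m T l h m j x * C m i x
    - \sum_m T l h i m x * C m j x.

(* R_h^l_ij|k *)
Definition Rs_bar (R : realType) (g : point R -> 'M[R]_4) (Phi : sfun R)
    (l h i j k : 'I_3) : sfun R :=
  cov13 (sdelta g Phi k) (fun p q => Gammabar g Phi q p k) (Rs g Phi) l h i j.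

(* R_h^l_ij|0 *)
Definition Rs_bar0 (R : realType) (g : point R -> 'M[R]_4) (Phi : sfun R)
    (l h i j : 'I_3) : sfun R :=
  cov13 (xi R) (Kmix g Phi) (Rs g Phi) l h i j.

(* R_h^l_0i|k; the index 0 is not a tensor index. *)
Definition R0_bar (R : realType) (g : point R -> 'M[R]_4) (Phi : sfun R)
    (l h i k : 'I_3) : sfun R :=
  cov12 (sdelta g Phi k) (fun p q => Gammabar g Phi q p k) (R0 g Phi) l h i.

Definition cyc_sum (R : realType) (F : 'I_3 -> 'I_3 -> 'I_3 -> R)
    (i j k : 'I_3) : R :=
  F i j k + F j k i + F k i j.

(* Main.v *)
Require Import Defs.
From HB Require Import structures.
From mathcomp Require Import all_boot all_order all_algebra.
From mathcomp Require Import all_classical all_reals all_analysis.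
From mathcomp Require Import ring lra.
Import Order.TTheory GRing.Theory Num.Theory.
Import numFieldNormedType.Exports.
Local Open Scope classical_set_scope.
Local Open Scope ring_scope.
Set Implicit Arguments.
Unset Strict Implicit.
Unset Printing Implicit Defensive.

(** All fields are expressed in the adapted frame e_0 = d/dx^0,
    e_i = delta/delta x^i = d/dx^i - A_i d/dx^0. The bracket of any two of its
    vectors is a multiple of d/dx^0, [e_a, e_b] = c_ab e_0, with c_ij = -2 omega_ij
    and c_0i = a_i ([structure_coef_sp], [structure_coef_xi]). A connection on SM is
    then a family of four matrices C_a of functions, and the components of its
    curvature form the matrices
      F_ab = e_a C_b - e_b C_a + [C_a, C_b] - c_ab C_0.
    The three identities come from this formula ([scomp_Rbar]).

    The Koszul formula shows that the matrices of the spatial connection are made of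
    the Gammabar_i^k_j and K^k_i ([nabla_sdelta]). As Gammabar is symmetric, the
    Gammabar terms of F cancel in the cyclic sum of the first identity, and only
    the terms c_ab C_0 remain: these are the terms in omega and K
    ([first_bianchi]).

    For any connection, and any three vectors of the frame, the cyclic sum of
    e_a F_bd + [C_a, F_bd] - c_ab F_0d vanishes ([bianchi]); this uses only the
    commutators of the e_a, acting on functions, and their Jacobi identity. For
    three spatial vectors this is the second identity, for e_0 and two spatial
    vectors the third: the terms by which a covariant derivative of a spatial tensor
    acts on the remaining lower indices either cancel, by symmetry of Gammabar, or
    give the products of curvature and K in the third identity
    ([second_bianchi], [third_bianchi]).

    Two facts of calculus support this: the symmetry of second partial derivatives
    ([Clairaut]), and the smoothness of everything built from the metric by field
    operations and partial derivatives ([smooth_generated]). *)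

Local Notation scalar_field R := ('rV[R]_4 -> R).
Local Notation vector_field R := ('rV[R]_4 -> 'rV[R]_4).

(** * Symmetry of second derivatives *)

Section Clairaut.
Variables (R : realType) (V : normedModType R).
Implicit Types (F : V -> R) (u v x y : V).

(** The difference quotient at s of F along a line is that of F at the point of
    parameter s, so that directional derivatives inherit the mean value theorem
    of functions of one variable. *)
Lemma derive_line_quotient F v y s :
  (fun h : R => h^-1 *: (((fun r : R => F (r *: v + y)) \o shift s) (h *: (1 : R))
                         - F (s *: v + y)))
  = (fun h : R => h^-1 *: ((F \o shift (s *: v + y)) (h *: v) - F (s *: v + y))).
Proof. by apply/funext => h /=; rewrite [h%:A]mulr1 scalerDl addrA. Qed.

Lemma MVT_line F v y (h : R) : 0 < h ->
    (forall s : R, 0 <= s <= h -> derivable F (s *: v + y) v) ->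
  exists2 c, 0 <= c <= h & F (h *: v + y) - F y = h * 'D_v F (c *: v + y).
Proof.
move=> h0 dF; pose phi (s : R) := F (s *: v + y).
have dphi (s : R) : 0 <= s <= h -> is_derive s 1 phi ('D_v F (s *: v + y)).
  move=> /dF ds; apply: DeriveDef.
    by rewrite /derivable derive_line_quotient.
  by rewrite /derive derive_line_quotient.
have [||c /itvP cI E] := @MVT R phi (fun s => 'D_v F (s *: v + y)) _ _ h0.
- by move=> s /itvP sI; apply: dphi; rewrite !sI.
- apply: derivable_within_continuous => s /itvP sI.
  by have [] := dphi s; rewrite ?sI.
exists c; first by rewrite !cI.
by move: E; rewrite /phi scale0r add0r subr0 mulrC.
Qed.

Lemma derive_shift_quotient F v w y :
  (fun h : R => h^-1 *: (((fun z => F (z + w)) \o shift y) (h *: v) - F (y + w)))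
  = (fun h : R => h^-1 *: ((F \o shift (y + w)) (h *: v) - F (y + w))).
Proof. by apply/funext => h /=; rewrite addrA. Qed.

Lemma is_derive_shift F v w y : derivable F (y + w) v ->
  is_derive y v (fun z => F (z + w)) ('D_v F (y + w)).
Proof.
move=> dF; apply: DeriveDef.
  by rewrite /derivable derive_shift_quotient.
by rewrite /derive derive_shift_quotient.
Qed.

(** The mean value theorem along u for the increment of F along v, then along v
    for the derivative of F along u. *)
Lemma second_difference F u v x (h : R) : 0 < h ->
    (forall s t : R, 0 <= s <= h -> 0 <= t <= h ->
       derivable F (s *: u + (t *: v + x)) u /\
       derivable ('D_u F) (t *: v + (s *: u + x)) v) ->
  exists s t, [/\ 0 <= s <= h, 0 <= t <= h &
    (F (h *: u + (h *: v + x)) - F (h *: v + x)) - (F (h *: u + x) - F x)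
    = h * (h * 'D_v ('D_u F) (t *: v + (s *: u + x)))].
Proof.
move=> h0 dF; pose G z := F (z + h *: v) - F z.
have h01 : 0 <= (0 : R) <= h by rewrite lexx ltW.
have h11 : 0 <= h <= h by rewrite lexx ltW.
have dG (s : R) : 0 <= s <= h ->
    is_derive (s *: u + x) u G
      ('D_u F (s *: u + x + h *: v) - 'D_u F (s *: u + x)).
  move=> sh; apply: is_deriveB.
    apply: is_derive_shift; have [+ _] := dF s h sh h11.
    by rewrite -addrA [x + _]addrC.
  apply: derivableP; have [+ _] := dF s 0 sh h01.
  by rewrite scale0r add0r.
have [|s sh Es] := @MVT_line G u x h h0.
  by move=> s /dG[].
have [|t th Et] := @MVT_line ('D_u F) v (s *: u + x) h h0.
  by move=> t th; have [_] := dF s t sh th.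
exists s, t; split=> //.
have [_ DG] := dG s sh.
rewrite -Et [h *: v + (s *: u + x)]addrC -DG -Es /G.
rewrite -[h *: u + x + _]addrA [x + h *: v]addrC; ring.
Qed.

Lemma close_to_same (a b p q e : R) :
  `|a - p| <= e / 2 -> `|b - q| <= e / 2 -> p = q -> `|a - b| <= e.
Proof.
by move=> Ha Hb E; move: Hb; rewrite -E => Hb; rewrite !ler_norml in Ha Hb *; lra.
Qed.

(** The second difference of F over a small parallelogram at x is symmetric in u
    and v. Divided by the square of the scale, it is a value of either mixed
    derivative at some point close to x; continuity at x does the rest. *)
Lemma Clairaut F u v x :
    (\forall y \near x, [/\ derivable F y u, derivable F y v,
       derivable ('D_u F) y v & derivable ('D_v F) y u]) ->
    {for x, continuous ('D_v ('D_u F))} ->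
    {for x, continuous ('D_u ('D_v F))} ->
  'D_v ('D_u F) x = 'D_u ('D_v F) x.
Proof.
move=> dF cvu cuv; apply/eqP; rewrite -subr_eq0 -normr_le0.
apply/ler_addgt0Pr => e e0.
have e20 : 0 < e / 2 by rewrite divr_gt0.
have /nbhs_ballP[r /= r0 Hr] : nbhs x [set y |
    [/\ derivable F y u, derivable F y v,
       derivable ('D_u F) y v & derivable ('D_v F) y u] /\
    (`|'D_v ('D_u F) x - 'D_v ('D_u F) y| < e / 2 /\
     `|'D_u ('D_v F) x - 'D_u ('D_v F) y| < e / 2)].
  apply: filterI; first exact: dF.
  apply: filterI.
    by move/cvgrPdist_lt: cvu => /(_ _ e20).
  by move/cvgrPdist_lt: cuv => /(_ _ e20).
pose M := `|u| + `|v| + 1.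
have M0 : 0 < M by rewrite /M ltr_wpDl// addr_ge0.
(* With this scale the parallelogram lies in the ball of radius r. *)
pose h := r / 2 / M.
have h0 : 0 < h by rewrite /h !divr_gt0.
have near (s t : R) : 0 <= s <= h -> 0 <= t <= h -> ball x r (s *: u + (t *: v + x)).
  move=> /andP[s0 sh] /andP[t0 th]; rewrite -ball_normE /= addrA opprD addrCA.
  rewrite subrr addr0 normrN; apply: le_lt_trans (ler_normD _ _) _.
  rewrite !normrZ !ger0_norm //.
  apply: (@le_lt_trans _ _ (h * M)).
    rewrite /M !mulrDr mulr1 -addrA lerD // ?ler_wpM2r //.
    by rewrite -[leLHS]addr0 lerD // ?ler_wpM2r // ltW.
  by rewrite /h divfK ?gt_eqF // ltr_pdivrMr // mulr_natr mulr2n ltrDl.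
have near' (s t : R) : 0 <= s <= h -> 0 <= t <= h -> ball x r (t *: v + (s *: u + x)).
  by move=> sh th; rewrite addrCA; apply: near.
have [|s [t [sh th E1]]] := @second_difference F u v x h h0.
  move=> s t sh th; split.
    by have [[]] := Hr _ (near _ _ sh th).
  by have [[]] := Hr _ (near' _ _ sh th).
have [|s' [t' [sh' th' E2]]] := @second_difference F v u x h h0.
  move=> s' t' sh' th'; split.
    by have [[]] := Hr _ (near' _ _ th' sh').
  by have [[]] := Hr _ (near _ _ th' sh').
have [_ [B1 _]] := Hr _ (near' _ _ sh th).
have [_ [_ B2]] := Hr _ (near _ _ th' sh').
rewrite add0r; apply: (close_to_same (ltW B1) (ltW B2)).
apply: (mulfI (lt0r_neq0 h0)); apply: (mulfI (lt0r_neq0 h0)).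
apply: etrans (esym E1) _; apply: etrans E2.
rewrite [h *: v + (h *: u + x)]addrCA.
by rewrite opprB addrACA [- _ - _]addrC addrACA opprB.
Qed.

End Clairaut.

(** * Smooth functions on an open set *)

Section SmoothFunctions.
Variables (R : realType) (U : set 'rV[R]_4).
Hypothesis U_open : open U.
Implicit Types (f g : scalar_field R) (X Y : vector_field R) (x : 'rV[R]_4) (a b : 'I_4).

(** The condition of [smooth_on] for the empty sequence of derivatives. *)
Definition regular f := forall x, U x ->
  {for x, continuous f} /\ forall a, derivable f x (delta_mx 0 a).

Lemma near_U x : U x -> \forall y \near x, U y.
Proof. by move=> Ux; apply: open_nbhs_nbhs. Qed.

Lemma pd_ext f g a x : {in U, f =1 g} -> U x -> pd a f x = pd a g x.
Proof.
move=> fg Ux; apply: near_eq_derive; near=> y; apply: fg.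
by apply/mem_set; near: y; apply: near_U.
Unshelve. all: by end_near. Qed.

Lemma pd_cst (c : R) a x : pd a (fun=> c) x = 0.
Proof. exact: derive_cst. Qed.

Lemma regular_ext f g : {in U, f =1 g} -> regular f -> regular g.
Proof.
move=> fg rf x Ux; have [cf df] := rf x Ux.
have fg' : {near x, f =1 g}.
  near=> y; apply: fg; apply/mem_set; near: y; exact: near_U.
split=> [|a]; last exact: near_eq_derivable fg' (df a).
have -> : {for x, continuous g} = (g @ x --> f x) by rewrite (fg x (mem_set Ux)).
exact: cvg_trans (near_eq_cvg fg') cf.
Unshelve. all: by end_near. Qed.

(** The smallest class of functions that contains the smooth ones and is closed
    under the pointwise operations of a field; it is stable under the partial
    derivatives, hence consists of smooth functions. *)
Inductive generated : scalar_field R -> Prop :=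
| generated_smooth f : smooth_on U f -> generated f
| generated_cst c : generated (fun=> c)
| generatedD f g : generated f -> generated g -> generated (fun x => f x + g x)
| generatedM f g : generated f -> generated g -> generated (fun x => f x * g x)
| generatedV f : generated f -> (forall x, U x -> f x != 0) ->
    generated (fun x => (f x)^-1)
| generated_ext f g : generated f -> {in U, f =1 g} -> generated g.

Lemma smooth_regular f : smooth_on U f -> regular f.
Proof. by move=> sf x Ux; apply: (sf [::] x Ux). Qed.

Lemma smooth_pd f a : smooth_on U f -> smooth_on U (pd a f).
Proof. by move=> sf s x Ux; have := sf (rcons s a) x Ux; rewrite foldr_rcons. Qed.

Lemma generated_regular f : generated f -> regular f.
Proof.
elim=> {f} [f /smooth_regular //|c|f g _ rf _ rg|f g _ rf _ rg|f _ rf f0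
  |f g _ rf fg].
- by move=> x _; split=> [|a]; [exact: cst_continuous | exact: derivable_cst].
- move=> x Ux; have [cf df] := rf x Ux; have [cg dg] := rg x Ux.
  by split=> [|a]; [exact: continuousD | exact: derivableD].
- move=> x Ux; have [cf df] := rf x Ux; have [cg dg] := rg x Ux.
  by split=> [|a]; [exact: continuousM | exact: derivableM].
- move=> x Ux; have [cf df] := rf x Ux.
  by split=> [|a]; [exact: continuousV (f0 x Ux) cf | exact: derivableV (f0 x Ux) (df a)].
- exact: regular_ext rf.
Qed.

Lemma pdD f g a x : regular f -> regular g -> U x ->
  pd a (fun y => f y + g y) x = pd a f x + pd a g x.
Proof.
by move=> rf rg Ux; apply: deriveD; [have [] := rf x Ux | have [] := rg x Ux].
Qed.

Lemma pdM f g a x : regular f -> regular g -> U x ->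
  pd a (fun y => f y * g y) x = f x * pd a g x + g x * pd a f x.
Proof.
by move=> rf rg Ux; apply: deriveM; [have [] := rf x Ux | have [] := rg x Ux].
Qed.

Lemma generated_pd f a : generated f -> generated (pd a f).
Proof.
elim=> {f} [f sf|c|f g gf gpf gg gpg|f g gf gpf gg gpg|f gf gpf f0
  |f g _ gf fg].
- exact/generated_smooth/smooth_pd.
- apply: generated_ext (generated_cst 0) _ => x _; exact/esym/pd_cst.
- apply: generated_ext (generatedD gpf gpg) _ => x /set_mem Ux.
  by rewrite pdD //; apply: generated_regular.
- apply: generated_ext (generatedD (generatedM gf gpg) (generatedM gg gpf)) _.
  by move=> x /set_mem Ux; rewrite pdM //; apply: generated_regular.
- have gi := generatedV gf f0.
  apply: generated_ext (generatedM (generatedM (generated_cst (-1))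
    (generatedM gi gi)) gpf) _ => x /set_mem Ux.
  have [_ df] := generated_regular gf Ux.
  by rewrite /pd deriveV ?f0 // mulN1r -invfM -expr2.
- apply: generated_ext gf _ => x /set_mem Ux; exact: pd_ext.
Qed.

(** By induction on the sequence of derivatives, taken from the inside: each of
    them stays in the class. *)
Lemma smooth_generated f : generated f -> smooth_on U f.
Proof.
move=> gf s; elim/last_ind: s f gf => [|s a IH] f gf x Ux.
  exact: generated_regular gf x Ux.
by rewrite foldr_rcons; apply: IH Ux; apply: generated_pd.
Qed.

Lemma smooth_ext f g : {in U, f =1 g} -> smooth_on U f -> smooth_on U g.
Proof.
by move=> fg sf; apply/smooth_generated/(generated_ext _ fg)/generated_smooth.
Qed.

Lemma smooth_cst (c : R) : smooth_on U (fun=> c).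
Proof. exact/smooth_generated/generated_cst. Qed.

Lemma smoothD f g : smooth_on U f -> smooth_on U g ->
  smooth_on U (fun x => f x + g x).
Proof.
by move=> sf sg; apply/smooth_generated/generatedD; apply: generated_smooth.
Qed.

Lemma smoothM f g : smooth_on U f -> smooth_on U g ->
  smooth_on U (fun x => f x * g x).
Proof.
by move=> sf sg; apply/smooth_generated/generatedM; apply: generated_smooth.
Qed.

Lemma smoothV f : smooth_on U f -> (forall x, U x -> f x != 0) ->
  smooth_on U (fun x => (f x)^-1).
Proof.
by move=> sf f0; apply/smooth_generated/generatedV=> //; apply: generated_smooth.
Qed.

Lemma smoothN f : smooth_on U f -> smooth_on U (fun x => - f x).
Proof.
by move=> sf; apply: smooth_ext (smoothM (smooth_cst (-1)) sf) => x _; rewrite mulN1r.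
Qed.

Lemma smoothB f g : smooth_on U f -> smooth_on U g ->
  smooth_on U (fun x => f x - g x).
Proof. by move=> sf sg; apply: smoothD sf (smoothN sg). Qed.

Lemma smooth_sum (I : Type) (s : seq I) (P : pred I) (F : I -> scalar_field R) :
  (forall i, smooth_on U (F i)) -> smooth_on U (fun x => \sum_(i <- s | P i) F i x).
Proof.
move=> sF; elim: s => [|i s IH].
  by apply: smooth_ext (smooth_cst 0) => x _; rewrite big_nil.
case Pi : (P i).
  by apply: smooth_ext (smoothD (sF i) IH) => x _; rewrite big_cons Pi.
by apply: smooth_ext IH => x _; rewrite big_cons Pi.
Qed.

Lemma smooth_prod (I : Type) (s : seq I) (P : pred I) (F : I -> scalar_field R) :
  (forall i, smooth_on U (F i)) -> smooth_on U (fun x => \prod_(i <- s | P i) F i x).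
Proof.
move=> sF; elim: s => [|i s IH].
  by apply: smooth_ext (smooth_cst 1) => x _; rewrite big_nil.
case Pi : (P i).
  by apply: smooth_ext (smoothM (sF i) IH) => x _; rewrite big_cons Pi.
by apply: smooth_ext IH => x _; rewrite big_cons Pi.
Qed.

Lemma smooth_det n (A : 'rV[R]_4 -> 'M[R]_n) :
  (forall i j, smooth_on U (fun x => A x i j)) -> smooth_on U (fun x => \det (A x)).
Proof.
move=> sA; apply: smooth_sum => s; apply: smoothM; first exact: smooth_cst.
by apply: smooth_prod => i; apply: sA.
Qed.

Lemma smooth_invmx n (A : 'rV[R]_4 -> 'M[R]_n) :
    (forall i j, smooth_on U (fun x => A x i j)) ->
    (forall x, U x -> A x \in unitmx) ->
  forall i j, smooth_on U (fun x => invmx (A x) i j).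
Proof.
move=> sA uA i j.
have sadj : smooth_on U (fun x => (\adj (A x)) i j).
  apply: (@smooth_ext (fun x => (-1) ^+ (j + i) * \det (row' j (col' i (A x))))).
    by move=> x _; rewrite mxE.
  apply: smoothM; first exact: smooth_cst.
  apply: smooth_det => k l.
  by apply: (@smooth_ext (fun x => A x (lift j k) (lift i l))) => // x _; rewrite !mxE.
have sdet : smooth_on U (fun x => (\det (A x))^-1).
  by apply: smoothV (smooth_det sA) _ => x /uA; rewrite unitmxE unitfE.
apply: smooth_ext (smoothM sdet sadj) => x /set_mem Ux.
by rewrite /invmx (uA x Ux) [RHS]mxE.
Qed.

Lemma pd_comm f a b x : smooth_on U f -> U x ->
  pd a (pd b f) x = pd b (pd a f) x.
Proof.
move=> sf Ux; apply: Clairaut.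
- near=> y.
  have Uy : U y by near: y; apply: near_U.
  split; [exact: (sf [::] y Uy).2 b | exact: (sf [::] y Uy).2 a |
    exact: (sf [:: b] y Uy).2 a | exact: (sf [:: a] y Uy).2 b].
- exact: (sf [:: a; b] x Ux).1.
- exact: (sf [:: b; a] x Ux).1.
Unshelve. all: by end_near. Qed.

Lemma vderE X f x : vder X f x = \sum_a X x 0 a * pd a f x.
Proof. by []. Qed.

Lemma vder_at X X' f x : X x = X' x -> vder X f x = vder X' f x.
Proof. by rewrite /vder => ->. Qed.

Lemma vder_ext X f g x : {in U, f =1 g} -> U x -> vder X f x = vder X g x.
Proof.
by move=> fg Ux; apply: eq_bigr => a _; rewrite (pd_ext _ fg).
Qed.

Lemma vder_cst X (c : R) x : vder X (fun=> c) x = 0.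
Proof. by rewrite /vder big1 // => a _; rewrite pd_cst mulr0. Qed.

Lemma vderD X f g x : smooth_on U f -> smooth_on U g -> U x ->
  vder X (fun y => f y + g y) x = vder X f x + vder X g x.
Proof.
move=> /smooth_regular rf /smooth_regular rg Ux; rewrite -big_split /=.
by apply: eq_bigr => a _; rewrite pdD // mulrDr.
Qed.

Lemma vderM X f g x : smooth_on U f -> smooth_on U g -> U x ->
  vder X (fun y => f y * g y) x = vder X f x * g x + f x * vder X g x.
Proof.
move=> /smooth_regular rf /smooth_regular rg Ux.
rewrite /vder big_distrl big_distrr -big_split /=.
by apply: eq_bigr => a _; rewrite (pdM _ rf rg Ux); ring.
Qed.

Lemma vderN X f x : smooth_on U f -> U x ->
  vder X (fun y => - f y) x = - vder X f x.
Proof.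
move=> sf Ux; have -> : (fun y => - f y) = (fun y => -1 * f y).
  by apply/funext => y; rewrite mulN1r.
by rewrite (vderM _ (smooth_cst _) sf Ux) vder_cst mul0r add0r mulN1r.
Qed.

Lemma vderB X f g x : smooth_on U f -> smooth_on U g -> U x ->
  vder X (fun y => f y - g y) x = vder X f x - vder X g x.
Proof. by move=> sf sg Ux; rewrite (vderD _ sf (smoothN sg) Ux) (vderN _ sg Ux). Qed.

Lemma vder_sum X (I : Type) (s : seq I) (F : I -> scalar_field R) x :
    (forall i, smooth_on U (F i)) -> U x ->
  vder X (fun y => \sum_(i <- s) F i y) x = \sum_(i <- s) vder X (F i) x.
Proof.
move=> sF Ux; elim: s => [|i s IH].
  rewrite big_nil; apply: etrans (vder_cst X 0 x).
  by apply: vder_ext => // y _; rewrite big_nil.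
rewrite big_cons -IH -(vderD _ (sF i) (smooth_sum _ _ sF) Ux).
by apply: vder_ext => // y _; rewrite big_cons.
Qed.

Lemma vder_fieldD X Y f x :
  vder (fun y => X y + Y y) f x = vder X f x + vder Y f x.
Proof.
by rewrite /vder -big_split /=; apply: eq_bigr => a _; rewrite mxE mulrDl.
Qed.

Lemma vder_fieldZ (c : scalar_field R) X f x :
  vder (fun y => c y *: X y) f x = c x * vder X f x.
Proof.
by rewrite /vder big_distrr /=; apply: eq_bigr => a _; rewrite mxE mulrA.
Qed.

Lemma vder_dcoord a f x : vder (dcoord R a) f x = pd a f x.
Proof.
rewrite /vder (bigD1 a) //= big1 ?addr0 => [|b ba].
  by rewrite /dcoord mxE !eqxx mul1r.
by rewrite /dcoord mxE (negPf ba) andbF mul0r.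
Qed.

Lemma smooth_vder X f : (forall a, smooth_on U (fun x => X x 0 a)) ->
  smooth_on U f -> smooth_on U (vder X f).
Proof.
by move=> sX sf; apply: smooth_sum => a; apply: smoothM (sX a) (smooth_pd a sf).
Qed.

End SmoothFunctions.

(** * Frames with brackets along one vector, and their connections *)

(* Otherwise unification unfolds derivatives to limits, and [apply] takes the
   quantifiers inside [smooth_on] for premises of the goal. *)
Opaque pd vder smooth_on.

(* To be used before [ring] and [lra], which compare atoms up to conversion and
   would unfold these values down to limits and matrix products. *)
Ltac generalize_values := repeat match goal with
  | |- context [vder ?X ?f ?x] => generalize (vder X f x); intro
  | |- context [pd ?a ?f ?x] => generalize (pd a f x); intro
  | |- context [gprod ?g ?X ?Y ?x] => generalize (gprod g X Y x); intro
  | |- context [omega ?g ?Phi ?i ?j ?x] => generalize (omega g Phi i j x); intro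
  | |- context [Kmix ?g ?Phi ?i ?j ?x] => generalize (Kmix g Phi i j x); intro
  | |- context [acoef ?g ?Phi ?i ?x] => generalize (acoef g Phi i x); intro
  | |- context [R0 ?g ?Phi ?l ?h ?i ?x] => generalize (R0 g Phi l h i x); intro
  end.

Section CurvatureAlgebra.
Variables (R : comPzRingType) (n : nat) (I : Type) (o : I).
Variables (C : I -> 'M[R]_n) (E : I -> I -> 'M[R]_n) (EE : I -> I -> I -> 'M[R]_n).
Variables (c : I -> I -> R) (Ec : I -> I -> I -> R).
Implicit Types a b d : I.

Definition curv_at a b := E a b - E b a + (C a *m C b - C b *m C a) - c a b *: C o.

Definition dcurv_at d a b := EE d a b - EE d b a
  + (E d a *m C b + C a *m E d b - (E d b *m C a + C b *m E d a))
  - (Ec d a b *: C o + c a b *: E d o).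

Definition covcurv_at d a b :=
  dcurv_at d a b + (C d *m curv_at a b - curv_at a b *m C d).

(** The values at one point of connection matrices [C a], of their derivatives
    along vectors e_a with [e_a, e_b] = c a b e_o, and of the derivatives of the
    coefficients c. In d(F) + [C, F] the second derivatives of C combine to
    commutators of the e_a, which the terms with c absorb; the products of three
    matrices cancel, and what multiplies [C o] vanishes by the Jacobi identity. *)
Lemma bianchi_mx a b d :
    (forall p q r, EE p q r = EE q p r + c p q *: E o r) ->
    (c a b * c o d - Ec d a b) + (c b d * c o a - Ec a b d)
      + (c d a * c o b - Ec b d a) = 0 ->
  (covcurv_at a b d - c a b *: curv_at o d)
  + (covcurv_at b d a - c b d *: curv_at o a)
  + (covcurv_at d a b - c d a *: curv_at o b) = 0.
Proof.
move=> comm jacobi; rewrite /covcurv_at /dcurv_at /curv_at.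
rewrite (comm d a) (comm a b) (comm b d).
rewrite !(mulmxDl, mulmxDr, mulmxBl, mulmxBr, mulmxN, mulNmx) -!scalemxAl -!scalemxAr.
rewrite !mulmxA; apply/matrixP => l h; move: jacobi => /(congr1 ( *%R (C o l h))).
do ![rewrite mxE /=].
by rewrite mulr0 => J; apply: etrans J; ring.
Qed.

End CurvatureAlgebra.

Section AdaptedFrame.
Variables (R : realType) (U : set 'rV[R]_4) (A : 'I_4 -> scalar_field R).
Hypotheses (U_open : open U) (A_smooth : forall a, smooth_on U (A a)).
Hypothesis A0 : A ord0 = fun=> 0.
Implicit Types (f : scalar_field R) (x : 'rV[R]_4) (a b d p : 'I_4).

Definition frame a : vector_field R := fun x => dcoord R a x - A a x *: xi R x.

(** The coefficient c_ab of [e_a, e_b] = c_ab d/dx^0; see [bracket_frame]. *)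
Definition structure_coef a b : scalar_field R :=
  fun x => vder (frame b) (A a) x - vder (frame a) (A b) x.

Lemma frameE a x p : frame a x 0 p = (p == a)%:R - A a x * (p == ord0)%:R.
Proof. by rewrite /frame /xi /dcoord !mxE. Qed.

Lemma frame_ord0 : frame ord0 = xi R.
Proof. by apply/funext => x; rewrite /frame A0 scale0r subr0. Qed.

Lemma smooth_frame a p : smooth_on U (fun x => frame a x 0 p).
Proof.
apply: (@smooth_ext _ _ U_open (fun x => (p == a)%:R - A a x * (p == ord0)%:R)).
  by move=> x _; rewrite frameE.
apply: smoothB => //; first exact: smooth_cst.
by apply: smoothM => //; exact: smooth_cst.
Qed.

Lemma vder_frame a f x : vder (frame a) f x = pd a f x - A a x * pd ord0 f x.
Proof.
have -> : frame a = (fun y => dcoord R a y + (- A a y) *: xi R y).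
  by apply/funext => y; rewrite /frame scaleNr.
by rewrite vder_fieldD (vder_fieldZ (fun y => - A a y)) !vder_dcoord mulNr.
Qed.

Lemma smooth_vder_frame a f : smooth_on U f -> smooth_on U (vder (frame a) f).
Proof. exact: smooth_vder (smooth_frame a). Qed.

Lemma smooth_structure_coef a b : smooth_on U (structure_coef a b).
Proof. by apply: smoothB => //; apply: smooth_vder_frame. Qed.

Lemma vder_frame_comp a b p x : U x ->
  vder (frame a) (fun y => frame b y 0 p) x
  = - vder (frame a) (A b) x * (p == ord0)%:R.
Proof.
move=> Ux; have sc c := smooth_cst U_open c.
rewrite (@vder_ext _ _ U_open _ _ (fun y => (p == b)%:R - A b y * (p == ord0)%:R)) //.
  rewrite (vderB U_open _ (sc _) (smoothM U_open (A_smooth b) (sc _)) Ux).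
  by rewrite (vderM _ (A_smooth b) (sc _) Ux) !vder_cst; ring.
by move=> y _; rewrite frameE.
Qed.

Lemma bracket_frame a b x : U x ->
  bracket (frame a) (frame b) x = structure_coef a b x *: xi R x.
Proof.
move=> Ux; apply/rowP => p.
by rewrite /bracket !mxE !vder_frame_comp // /structure_coef; ring.
Qed.

(** The second derivatives of f cancel by [pd_comm]; what remains comes from the
    derivatives of the coefficients A. *)
Lemma vder_frame_comm a b f x : smooth_on U f -> U x ->
  vder (frame a) (vder (frame b) f) x - vder (frame b) (vder (frame a) f) x
  = structure_coef a b x * pd ord0 f x.
Proof.
move=> sf Ux.
have E e d : vder (frame e) (vder (frame d) f) x =
    pd e (pd d f) x - A e x * pd ord0 (pd d f) x
    - (vder (frame e) (A d) x * pd ord0 f x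
       + A d x * (pd e (pd ord0 f) x - A e x * pd ord0 (pd ord0 f) x)).
  have sp d' := smooth_pd d' sf.
  rewrite (@vder_ext _ _ U_open _ _ (fun y => pd d f y - A d y * pd ord0 f y)) //.
    rewrite (vderB U_open _ (sp _) (smoothM U_open (A_smooth d) (sp _)) Ux).
    rewrite (vderM _ (A_smooth d) (sp _) Ux).
    by rewrite (vder_frame e (pd d f)) (vder_frame e (pd ord0 f)).
  by move=> y _; rewrite vder_frame.
move: (pd_comm U_open b a sf Ux) (pd_comm U_open ord0 a sf Ux).
move: (pd_comm U_open ord0 b sf Ux); rewrite !E /structure_coef.
by generalize_values => -> -> ->; ring.
Qed.

Lemma structure_coefC a b x : structure_coef b a x = - structure_coef a b x.
Proof. by rewrite /structure_coef opprB. Qed.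

Lemma structure_coef_ord0 b x : structure_coef ord0 b x = - pd ord0 (A b) x.
Proof.
by rewrite /structure_coef !vder_frame A0 !pd_cst; generalize_values; ring.
Qed.

(** The Jacobi identity for three vectors of the frame. As the structure
    coefficients are themselves derivatives of the A_a, it follows from the
    commutators acting on the A_a. *)
Lemma structure_coef_jacobi a b d x : U x ->
  (structure_coef a b x * structure_coef ord0 d x
     - vder (frame d) (structure_coef a b) x)
  + (structure_coef b d x * structure_coef ord0 a x
     - vder (frame a) (structure_coef b d) x)
  + (structure_coef d a x * structure_coef ord0 b x
     - vder (frame b) (structure_coef d a) x) = 0.
Proof.
move=> Ux.
have E p q r : vder (frame r) (structure_coef p q) x =
    vder (frame r) (vder (frame q) (A p)) x - vder (frame r) (vder (frame p) (A q)) x.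
  exact: (vderB U_open _ (smooth_vder_frame _ (A_smooth _))
    (smooth_vder_frame _ (A_smooth _)) Ux).
rewrite !E !structure_coef_ord0.
have := vder_frame_comm a b (A_smooth d) Ux.
have := vder_frame_comm b d (A_smooth a) Ux.
have := vder_frame_comm d a (A_smooth b) Ux.
by generalize_values; lra.
Qed.

Section Connection.
Variables (n : nat) (C : 'I_4 -> 'I_n -> 'I_n -> scalar_field R).
Hypothesis C_smooth : forall a l h, smooth_on U (C a l h).
Implicit Types (l h m : 'I_n).

(** [curv a b l h] is the l-component of R(e_a, e_b) s_h for the connection with
    nabla_(e_a) s_h = C a l h s_l. *)
Definition curv a b l h : scalar_field R := fun x =>
  vder (frame a) (C b l h) x - vder (frame b) (C a l h) x
  + \sum_m (C a l m x * C b m h x - C b l m x * C a m h x)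
  - structure_coef a b x * C ord0 l h x.

Lemma smooth_curv a b l h : smooth_on U (curv a b l h).
Proof.
apply: smoothB (smoothM U_open (smooth_structure_coef a b) (C_smooth ord0 l h)) => //.
apply: smoothD => //.
  exact: smoothB (smooth_vder_frame a _) (smooth_vder_frame b _).
apply: (smooth_sum U_open) => m.
exact: smoothB (smoothM U_open (C_smooth _ _ _) (C_smooth _ _ _))
  (smoothM U_open (C_smooth _ _ _) (C_smooth _ _ _)).
Qed.

Lemma curvC a b l h x : curv b a l h x = - curv a b l h x.
Proof.
rewrite /curv (structure_coefC a b).
have -> : \sum_m (C b l m x * C a m h x - C a l m x * C b m h x)
        = - \sum_m (C a l m x * C b m h x - C b l m x * C a m h x).
  by rewrite -sumrN; apply: eq_bigr => m _; rewrite opprB.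
ring.
Qed.

(** The derivative along e_a of the curvature as an endomorphism: its two vector
    arguments are fixed vectors of the frame and are not differentiated. *)
Definition cov_curv a b d l h : scalar_field R := fun x =>
  vder (frame a) (curv b d l h) x
  + \sum_m (C a l m x * curv b d m h x - curv b d l m x * C a m h x).

Let mC x a := \matrix_(l, h) C a l h x.
Let mE x a b := \matrix_(l, h) vder (frame a) (C b l h) x.
Let mEE x a b d := \matrix_(l, h) vder (frame a) (vder (frame b) (C d l h)) x.

Lemma curv_mx a b x : \matrix_(l, h) curv a b l h x =
  curv_at ord0 (mC x) (mE x) (fun p q => structure_coef p q x) a b.
Proof.
apply/matrixP => l h; rewrite /curv /curv_at !mxE; congr (_ + _ - _).
by rewrite sumrB; congr (_ - _); apply: eq_bigr => m _; rewrite !mxE.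
Qed.

Lemma vder_curv_mx a b d x : U x -> \matrix_(l, h) vder (frame a) (curv b d l h) x =
  dcurv_at ord0 (mC x) (mE x) (mEE x) (fun p q => structure_coef p q x)
    (fun r p q => vder (frame r) (structure_coef p q) x) a b d.
Proof.
move=> Ux; apply/matrixP => l h; rewrite /dcurv_at !mxE.
have sV p q : smooth_on U (vder (frame p) (C q l h)).
  exact: smooth_vder_frame.
have sM p q m : smooth_on U (fun y => C p l m y * C q m h y).
  exact: smoothM.
have sMM m := smoothB U_open (sM b d m) (sM d b m).
have sS := smooth_sum U_open (index_enum 'I_n) xpredT sMM.
have sc := smooth_structure_coef b d.
have sVV := smoothB U_open (sV b d) (sV d b).
apply: etrans (vderB U_open _ (smoothD U_open sVV sS)
  (smoothM U_open sc (C_smooth ord0 l h)) Ux) _.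
rewrite (vderD _ sVV sS Ux) (vderB U_open _ (sV b d) (sV d b) Ux).
rewrite (vderM _ sc (C_smooth ord0 l h) Ux) (vder_sum U_open _ _ sMM Ux).
congr (_ + _ - _); rewrite -!big_split -sumrB /=.
apply: eq_bigr => m _; rewrite (vderB U_open _ (sM b d m) (sM d b m) Ux).
by rewrite !(vderM _ (C_smooth _ _ _) (C_smooth _ _ _) Ux) !mxE.
Qed.

(** At each point this is [bianchi_mx] for the values of C and of its derivatives. *)
Lemma bianchi a b d l h x : U x ->
  (cov_curv a b d l h x - structure_coef a b x * curv ord0 d l h x)
  + (cov_curv b d a l h x - structure_coef b d x * curv ord0 a l h x)
  + (cov_curv d a b l h x - structure_coef d a x * curv ord0 b l h x) = 0.
Proof.
move=> Ux.
have EE p q r : mEE x p q r = mEE x q p r + structure_coef p q x *: mE x ord0 r.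
  apply/matrixP => l' h'; rewrite !mxE -[vder (frame ord0) _ x]/_.
  rewrite [in RHS]frame_ord0 vder_dcoord -(vder_frame_comm _ _ _ Ux) //.
  by rewrite addrC subrK.
pose c p q := structure_coef p q x.
pose dc r p q := vder (frame r) (structure_coef p q) x.
have covE p q r : cov_curv p q r l h x
    = covcurv_at ord0 (mC x) (mE x) (mEE x) c dc p q r l h.
  rewrite /covcurv_at -(vder_curv_mx p q r Ux) -(curv_mx q r x) /cov_curv !mxE.
  congr (_ + _); rewrite sumrB.
  by congr (_ - _); apply: eq_bigr => m _; rewrite !mxE.
have curvE p q : curv p q l h x = curv_at ord0 (mC x) (mE x) c p q l h.
  by rewrite -(curv_mx p q x) mxE.
rewrite !covE (curvE ord0 d) (curvE ord0 a) (curvE ord0 b).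
have J := @bianchi_mx _ _ _ ord0 (mC x) _ _ c dc a b d EE (structure_coef_jacobi a b d Ux).
have entry (X Y Z X' Y' Z' : 'M[R]_n) (r s t : R) :
    (X - r *: X') + (Y - s *: Y') + (Z - t *: Z') = 0 ->
    (X l h - r * X' l h) + (Y l h - s * Y' l h) + (Z l h - t * Z' l h) = 0.
  by move=> /(congr1 (fun M : 'M[R]_n => M l h)); rewrite !mxE.
exact: entry J.
Qed.

End Connection.
End AdaptedFrame.

(** * The Levi-Civita connection in coordinates *)

Section LeviCivita.
Variables (R : realType) (U : set 'rV[R]_4) (g : 'rV[R]_4 -> 'M[R]_4).
Hypotheses (U_open : open U) (g_smooth : forall a b, smooth_on U (fun x => g x a b)).
Hypotheses (g_sym : forall x, U x -> (g x)^T = g x).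
Hypotheses (g_unit : forall x, U x -> g x \in unitmx).
Implicit Types (f : scalar_field R) (X Y Z V W : vector_field R) (x : 'rV[R]_4).
Implicit Types (a b c d p q : 'I_4).

Definition smooth_field X := forall a, smooth_on U (fun x => X x 0 a).

Lemma gprodE X Y x :
  gprod g X Y x = \sum_a \sum_b X x 0 a * g x a b * Y x 0 b.
Proof.
rewrite /gprod mxE exchange_big; apply: eq_bigr => b _.
by rewrite !mxE big_distrl.
Qed.

Lemma smooth_gprod X Y : smooth_field X -> smooth_field Y -> smooth_on U (gprod g X Y).
Proof.
move=> sX sY.
apply: (smooth_ext U_open (f := fun y => \sum_a \sum_b X y 0 a * g y a b * Y y 0 b)).
  by move=> y _; rewrite gprodE.
apply: (smooth_sum U_open) => a; apply: (smooth_sum U_open) => b.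
exact: smoothM (smoothM U_open (sX _) (g_smooth _ _)) (sY _).
Qed.

Lemma gprodC X Y x : U x -> gprod g X Y x = gprod g Y X x.
Proof.
move=> Ux; rewrite /gprod -[in LHS](trmxK (_ *m _ *m _)) mxE !trmx_mul trmxK.
by rewrite g_sym // mulmxA.
Qed.

Lemma gprod_at X X' Y Y' x : X x = X' x -> Y x = Y' x ->
  gprod g X Y x = gprod g X' Y' x.
Proof. by rewrite /gprod => -> ->. Qed.

Lemma gprodZl f X Y x : gprod g (fun y => f y *: X y) Y x = f x * gprod g X Y x.
Proof. by rewrite /gprod -!scalemxAl mxE. Qed.

Lemma gprodBl X Y Z x :
  gprod g (fun y => X y - Y y) Z x = gprod g X Z x - gprod g Y Z x.
Proof. by rewrite /gprod !mulmxBl !mxE. Qed.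

Lemma gprod_suml (I : finType) (F : I -> vector_field R) Y x :
  gprod g (fun y => \sum_i F i y) Y x = \sum_i gprod g (F i) Y x.
Proof. by rewrite /gprod !mulmx_suml summxE. Qed.

Lemma gsymE x a b : U x -> g x a b = g x b a.
Proof. by move=> /g_sym => {2}<-; rewrite mxE. Qed.

Lemma pd_gC x a b d : U x -> pd d (fun y => g y a b) x = pd d (fun y => g y b a) x.
Proof. by apply: (pd_ext U_open) => // y /set_mem; apply: gsymE. Qed.

Lemma christoffelC x a b c : U x -> christoffel g c a b x = christoffel g c b a x.
Proof.
move=> Ux; rewrite /christoffel; congr (_ * _); apply: eq_bigr => d _.
by rewrite (pd_gC a b d Ux) [X in _ * (X - _)]addrC.
Qed.

(** The Christoffel symbols with the upper index lowered. *)
Lemma christoffel_low x a b d : U x ->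
  \sum_c g x d c * christoffel g c a b x =
  2^-1 * (pd a (fun y => g y d b) x + pd b (fun y => g y d a) x
          - pd d (fun y => g y a b) x).
Proof.
move=> Ux; pose L e := pd a (fun y => g y e b) x + pd b (fun y => g y e a) x
  - pd e (fun y => g y a b) x.
transitivity (2^-1 * \sum_e (g x *m invmx (g x)) d e * L e).
  rewrite big_distrr /=; under [RHS]eq_bigr do rewrite mxE big_distrl big_distrr.
  rewrite exchange_big; apply: eq_bigr => c _ /=.
  rewrite /christoffel !big_distrr /=.
  by apply: eq_bigr => e _; rewrite -/(L e); move: (L e) => r; ring.
rewrite mulmxV ?g_unit // (bigD1 d) //= big1 ?addr0; last first.
  by move=> e ed; rewrite mxE eq_sym (negPf ed) mul0r.
by rewrite mxE eqxx mul1r.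
Qed.

Lemma nabla_at X X' t Y x : X x = t *: X' x -> nabla g X Y x = t *: nabla g X' Y x.
Proof.
move=> XE; have vE f : vder X f x = t * vder X' f x.
  by rewrite -(vder_fieldZ (fun=> t)); apply: vder_at.
apply/rowP => c; rewrite !mxE vE mulrDr; congr (_ + _).
rewrite big_distrr; apply: eq_bigr => a _ /=; rewrite big_distrr.
by apply: eq_bigr => b _ /=; rewrite XE mxE; ring.
Qed.

Lemma nabla_ext X Y Y' x : (forall y, U y -> Y y = Y' y) -> U x ->
  nabla g X Y x = nabla g X Y' x.
Proof.
move=> YY Ux; apply/rowP => c; rewrite !mxE; congr (_ + _).
  by apply: (vder_ext U_open) => // y /set_mem /YY ->.
by rewrite (YY x Ux).
Qed.

Lemma nabla_sum (n : nat) X (f : 'I_n -> scalar_field R) (Y : 'I_n -> vector_field R) x :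
    (forall i, smooth_on U (f i)) -> (forall i, smooth_field (Y i)) -> U x ->
  nabla g X (fun y => \sum_i f i y *: Y i y) x
  = \sum_i (vder X (f i) x *: Y i x + f i x *: nabla g X (Y i) x).
Proof.
move=> sf sY Ux; apply/rowP => c; rewrite mxE summxE.
have sfY i : smooth_on U (fun y => f i y * Y i y 0 c).
  exact: smoothM (sY i c).
rewrite (@vder_ext _ _ U_open _ _ (fun y => \sum_i f i y * Y i y 0 c)) //; last first.
  by move=> y _; rewrite summxE; apply: eq_bigr => i _; rewrite mxE.
rewrite (vder_sum U_open _ _ sfY Ux).
have -> : \sum_a \sum_b
    christoffel g c a b x * X x 0 a * (\sum_i f i x *: Y i x) 0 b
  = \sum_i f i x * \sum_a \sum_b christoffel g c a b x * X x 0 a * Y i x 0 b.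
  under [RHS]eq_bigr => i _ do rewrite big_distrr.
  rewrite [RHS]exchange_big; apply: eq_bigr => a _ /=.
  under [RHS]eq_bigr => i _ do rewrite big_distrr.
  rewrite [RHS]exchange_big; apply: eq_bigr => b _ /=.
  rewrite summxE big_distrr; apply: eq_bigr => i _ /=.
  by rewrite mxE mulrCA.
rewrite -big_split; apply: eq_bigr => i _ /=.
by rewrite (vderM _ (sf i) (sY i c) Ux) !mxE mulrDr addrA.
Qed.

Lemma nabla_torsion X Y x : U x ->
  nabla g X Y x - nabla g Y X x = bracket X Y x.
Proof.
move=> Ux; apply/rowP => c; rewrite !mxE.
have -> : \sum_a \sum_b christoffel g c a b x * Y x 0 a * X x 0 b
        = \sum_a \sum_b christoffel g c a b x * X x 0 a * Y x 0 b.
  rewrite exchange_big; apply: eq_bigr => a _; apply: eq_bigr => b _ /=.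
  by rewrite (christoffelC _ _ _ Ux) mulrAC.
by rewrite opprD addrACA subrr addr0.
Qed.

(** With M d b = sum over a of X^a Gamma_(d a b), the metric satisfies
    X g_ab = M a b + M b a by [christoffel_low]; the two terms of this sum are what
    the Christoffel symbols contribute to the two products on the right. *)
Lemma nabla_metric X Y Z x : smooth_field Y -> smooth_field Z -> U x ->
  vder X (gprod g Y Z) x = gprod g (nabla g X Y) Z x + gprod g Y (nabla g X Z) x.
Proof.
move=> sY sZ Ux.
pose low d a b := \sum_c g x d c * christoffel g c a b x.
pose M d b := \sum_a X x 0 a * low d a b.
pose N (V : vector_field R) c :=
  \sum_a \sum_b christoffel g c a b x * X x 0 a * V x 0 b.
have gN V d : \sum_c g x d c * N V c = \sum_b M d b * V x 0 b.
  rewrite /M /N /low; under [RHS]eq_bigr => b _ do rewrite big_distrl.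
  rewrite exchange_big /=.
  under eq_bigr => c _ do rewrite big_distrr /=.
  rewrite exchange_big; apply: eq_bigr => a _ /=.
  under eq_bigr => c _ do rewrite big_distrr /=.
  rewrite exchange_big; apply: eq_bigr => b _ /=.
  rewrite big_distrr big_distrl /=; apply: eq_bigr => c _ /=.
  by move: (christoffel _ _ _ _ _) => r; ring.
have XgE a b : vder X (fun y => g y a b) x = M a b + M b a.
  rewrite vderE -big_split; apply: eq_bigr => p _ /=.
  rewrite -mulrDr /low !christoffel_low // (pd_gC b a p Ux) (pd_gC p b a Ux) (pd_gC p a b Ux).
  by congr (_ * _); generalize_values; field.
rewrite (@vder_ext _ _ U_open _ _
  (fun y => \sum_a \sum_b Y y 0 a * g y a b * Z y 0 b)) //; last first.
  by move=> y _; rewrite gprodE.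
have sYg a b := smoothM U_open (sY a) (g_smooth a b).
have sYgZ a b := smoothM U_open (sYg a b) (sZ b).
rewrite (vder_sum U_open _ _ (fun a => smooth_sum U_open _ _ (sYgZ a)) Ux).
have -> : gprod g (nabla g X Y) Z x
  = \sum_a \sum_b (vder X (fun y => Y y 0 a) x * g x a b * Z x 0 b
                   + Y x 0 a * M b a * Z x 0 b).
  rewrite gprodE; under eq_bigr => a _ do
    under eq_bigr => b _ do rewrite mxE -/(N Y a) mulrDl mulrDl.
  under eq_bigr => a _ do rewrite big_split /=.
  under [RHS]eq_bigr => a _ do rewrite big_split /=.
  rewrite !big_split; congr (_ + _) => /=.
  rewrite exchange_big [RHS]exchange_big; apply: eq_bigr => b _ /=.
  rewrite -!big_distrl /=; congr (_ * _).
  under eq_bigr => a _ do rewrite mulrC (gsymE a b Ux).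
  by rewrite gN; apply: eq_bigr => a _; rewrite mulrC.
have -> : gprod g Y (nabla g X Z) x
  = \sum_a \sum_b (Y x 0 a * g x a b * vder X (fun y => Z y 0 b) x
                   + Y x 0 a * M a b * Z x 0 b).
  rewrite gprodE; apply: eq_bigr => a _.
  under eq_bigr => b _ do rewrite mxE -/(N Z b) mulrDr.
  rewrite !big_split; congr (_ + _) => /=.
  under eq_bigr => b _ do rewrite -mulrA.
  under [RHS]eq_bigr => b _ do rewrite -mulrA.
  by rewrite -!big_distrr /= gN.
rewrite -big_split; apply: eq_bigr => a _ /=.
rewrite (vder_sum U_open _ _ (sYgZ a) Ux) -big_split; apply: eq_bigr => b _ /=.
rewrite (vderM _ (sYg a b) (sZ b) Ux) (vderM _ (sY a) (g_smooth a b) Ux) XgE.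
by generalize_values; ring.
Qed.

(** The usual combination of [nabla_metric] and [nabla_torsion]. *)
Lemma koszul X Y Z x : smooth_field X -> smooth_field Y -> smooth_field Z -> U x ->
  2 * gprod g (nabla g X Y) Z x =
  vder X (gprod g Y Z) x + vder Y (gprod g X Z) x - vder Z (gprod g X Y) x
  + gprod g (bracket X Y) Z x - gprod g (bracket X Z) Y x - gprod g (bracket Y Z) X x.
Proof.
move=> sX sY sZ Ux.
have tors (V W V' : vector_field R) : gprod g (bracket V W) V' x
    = gprod g (nabla g V W) V' x - gprod g (nabla g W V) V' x.
  by rewrite -gprodBl; apply: gprod_at => //; rewrite nabla_torsion.
rewrite !nabla_metric // !tors.
rewrite (gprodC Y (nabla g X Z) Ux) (gprodC X (nabla g Y Z) Ux) (gprodC X (nabla g Z Y) Ux).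
by generalize_values; ring.
Qed.

End LeviCivita.

(** * The spatial connection and its curvature *)

Section SpatialConnection.
Variables (R : realType) (U : set 'rV[R]_4) (g : 'rV[R]_4 -> 'M[R]_4).
Variable Phi : scalar_field R.
Hypotheses (U_open : open U) (g_smooth : forall a b, smooth_on U (fun x => g x a b)).
Hypotheses (g_sym : forall x, U x -> (g x)^T = g x).
Hypotheses (g_unit : forall x, U x -> g x \in unitmx).
Hypotheses (Phi_smooth : smooth_on U Phi) (Phi_neq0 : forall x, U x -> Phi x != 0).
Hypothesis g_xi : forall x, U x -> gprod g (xi R) (xi R) x = - (Phi x) ^+ 2.
Implicit Types (f : scalar_field R) (X Y V W : vector_field R) (x : 'rV[R]_4).
Implicit Types (a b : 'I_4) (h i j k l m : 'I_3).

(** The value 0 at index 0 makes the first vector of the frame d/dx^0 itself. *)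
Definition threading_coef a : scalar_field R :=
  if unlift ord0 a is Some i then Acoef g Phi i else fun=> 0.

Local Notation e a := (frame threading_coef a).
Local Notation str a b := (structure_coef threading_coef a b).

Lemma threading_coef0 : threading_coef ord0 = fun=> 0.
Proof. by rewrite /threading_coef unlift_none. Qed.

Lemma threading_coef_sp i : threading_coef (sp i) = Acoef g Phi i.
Proof. by rewrite /threading_coef liftK. Qed.

Lemma frame_sp i : e (sp i) = sdelta g Phi i.
Proof. by rewrite /frame threading_coef_sp. Qed.

Lemma frame_xi : e ord0 = xi R.
Proof. exact/frame_ord0/threading_coef0. Qed.

Lemma smooth_dcoord a : smooth_field U (dcoord R a).
Proof. by move=> b; apply: smooth_cst. Qed.

Lemma smooth_Acoef i : smooth_on U (Acoef g Phi i).
Proof.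
have sV : smooth_on U (fun x => (Phi x * Phi x)^-1).
  by apply: smoothV (smoothM U_open Phi_smooth Phi_smooth) _ => // x /Phi_neq0 P0;
    rewrite mulf_neq0.
have sX : smooth_on U (xi_low g i).
  exact: smooth_gprod (smooth_dcoord _) (smooth_dcoord _).
apply: (smooth_ext U_open) (smoothN U_open (smoothM U_open sV sX)) => x _.
by rewrite /Acoef expr2 mulNr.
Qed.

Lemma smooth_threading_coef a : smooth_on U (threading_coef a).
Proof.
rewrite /threading_coef; case: (unlift ord0 a) => [i|].
  exact: smooth_Acoef.
exact: smooth_cst.
Qed.

Let sA := smooth_threading_coef.

Lemma smooth_field_frame a : smooth_field U (e a).
Proof. exact: smooth_frame. Qed.

Lemma smooth_field_sdelta i : smooth_field U (sdelta g Phi i).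
Proof. by rewrite -frame_sp; apply: smooth_field_frame. Qed.

Lemma gprod_sdelta_xi i x : U x -> gprod g (sdelta g Phi i) (xi R) x = 0.
Proof.
move=> Ux; rewrite gprodBl gprodZl g_xi // /Acoef -/(xi_low g i x).
by rewrite mulNr mulrNN mulrAC mulVf ?expf_neq0 ?Phi_neq0 // mul1r subrr.
Qed.

Lemma gprod_xi_sdelta i x : U x -> gprod g (xi R) (sdelta g Phi i) x = 0.
Proof. by move=> Ux; rewrite (gprodC g_sym) // gprod_sdelta_xi. Qed.

Lemma gbarE x i j : gbar g Phi x i j = gprod g (sdelta g Phi i) (sdelta g Phi j) x.
Proof. by rewrite mxE. Qed.

Lemma gbarC x i j : U x -> gbar g Phi x i j = gbar g Phi x j i.
Proof. by move=> Ux; rewrite !gbarE (gprodC g_sym). Qed.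

Lemma smooth_gbar i j : smooth_on U (fun x => gbar g Phi x i j).
Proof.
apply: (smooth_ext U_open) (smooth_gprod U_open g_smooth
  (smooth_field_sdelta i) (smooth_field_sdelta j)) => x _.
by rewrite gbarE.
Qed.

Lemma scomp_sdelta i l x : sdelta g Phi i x 0 (sp l) = (l == i)%:R.
Proof.
by rewrite -frame_sp frameE (inj_eq lift_inj) [_ == ord0]eq_sym (negPf (neq_lift _ _))
  mulr0 subr0.
Qed.

(** A combination of the delta/delta x^i that is orthogonal to all of them is
    also orthogonal to xi, hence to the whole tangent space. *)
Lemma gbar_unit x : U x -> gbar g Phi x \in unitmx.
Proof.
move=> Ux; rewrite -row_free_unit; apply: inj_row_free => v v0.
pose V : vector_field R := fun y => \sum_i v 0 i *: sdelta g Phi i y.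
have Vd j : gprod g V (sdelta g Phi j) x = 0.
  rewrite gprod_suml -[RHS](_ : (v *m gbar g Phi x) 0 j = 0); last by rewrite v0 mxE.
  rewrite mxE; apply: eq_bigr => i _.
  by rewrite (gprodZl g (fun=> v 0 i)) gbarE.
have Vx : gprod g V (xi R) x = 0.
  rewrite gprod_suml big1 // => i _.
  by rewrite (gprodZl g (fun=> v 0 i)) gprod_sdelta_xi // mulr0.
have VgE a : (V x *m g x) 0 a = gprod g V (dcoord R a) x.
  by rewrite /gprod /dcoord trmx_delta -colE !mxE.
have Vg : V x *m g x = 0.
  apply/rowP => a; rewrite VgE mxE; case: (unliftP ord0 a) => [j|] -> //.
  have := Vd j; rewrite !(gprodC g_sym V) // gprodBl gprodZl.
  by rewrite -[gprod g (xi R) V x](gprodC g_sym) // Vx mulr0 subr0.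
have V0 : V x = 0 by rewrite -[V x](mulmxK (g_unit Ux)) Vg mul0mx.
apply/rowP => j; rewrite mxE -[RHS](_ : V x 0 (sp j) = 0); last by rewrite V0 mxE.
rewrite summxE (bigD1 j) //= big1 ?addr0 => [|i ij]; rewrite mxE scomp_sdelta.
  by rewrite eqxx mulr1.
by rewrite eq_sym (negPf ij) mulr0.
Qed.

Lemma structure_coef_sp i j x : str (sp i) (sp j) x = - (2 * omega g Phi i j x).
Proof.
rewrite /structure_coef /omega !frame_sp !threading_coef_sp.
by generalize_values; field.
Qed.

Lemma structure_coef_xi i x : str ord0 (sp i) x = acoef g Phi i x.
Proof.
by rewrite (structure_coef_ord0 threading_coef0) threading_coef_sp.
Qed.

Lemma omegaC i j x : omega g Phi j i x = - omega g Phi i j x.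
Proof. by rewrite /omega -mulrN opprB. Qed.

Lemma gprod_bracket a b Y x : U x ->
  gprod g (bracket (e a) (e b)) Y x = str a b x * gprod g (xi R) Y x.
Proof.
move=> Ux; rewrite -(gprodZl g (fun=> str a b x)); apply: gprod_at => //.
exact: (bracket_frame U_open sA).
Qed.

Lemma gprod_bracket_sdelta i j Y x : U x ->
  gprod g (bracket (sdelta g Phi i) (sdelta g Phi j)) Y x
  = - (2 * omega g Phi i j x) * gprod g (xi R) Y x.
Proof.
move=> Ux; have := gprod_bracket (sp i) (sp j) Y Ux.
by rewrite !frame_sp structure_coef_sp.
Qed.

Lemma gprod_bracket_sdelta_sdelta i j l x : U x ->
  gprod g (bracket (sdelta g Phi i) (sdelta g Phi j)) (sdelta g Phi l) x = 0.
Proof. by move=> Ux; rewrite gprod_bracket_sdelta // gprod_xi_sdelta // mulr0. Qed.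

Lemma gprod_bracket_xi i l x : U x ->
  gprod g (bracket (xi R) (sdelta g Phi i)) (sdelta g Phi l) x = 0.
Proof.
move=> Ux; have := gprod_bracket ord0 (sp i) (sdelta g Phi l) Ux.
by rewrite frame_xi frame_sp gprod_xi_sdelta // mulr0.
Qed.

Lemma vder_gprod_sdelta X i j x : U x ->
  vder X (gprod g (sdelta g Phi i) (sdelta g Phi j)) x
  = vder X (fun y => gbar g Phi y j i) x.
Proof.
move=> Ux; apply: (vder_ext U_open) => // y /set_mem Uy.
by rewrite (gbarC _ _ Uy) gbarE.
Qed.

(** The bracket terms of the Koszul formula vanish: they are products of xi with
    vectors of SM. *)
Lemma koszul_sdelta j i l x : U x ->
  gprod g (nabla g (sdelta g Phi j) (sdelta g Phi i)) (sdelta g Phi l) x =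
  2^-1 * (vder (sdelta g Phi i) (fun y => gbar g Phi y l j) x
          + vder (sdelta g Phi j) (fun y => gbar g Phi y l i) x
          - vder (sdelta g Phi l) (fun y => gbar g Phi y i j) x).
Proof.
move=> Ux; have := koszul U_open g_smooth g_sym g_unit (smooth_field_sdelta j)
  (smooth_field_sdelta i) (smooth_field_sdelta l) Ux.
move: (gprod_bracket_sdelta_sdelta j i l Ux) (gprod_bracket_sdelta_sdelta j l i Ux).
move: (gprod_bracket_sdelta_sdelta i l j Ux).
move: (vder_gprod_sdelta (sdelta g Phi i) j l Ux).
move: (vder_gprod_sdelta (sdelta g Phi j) i l Ux).
move: (vder_gprod_sdelta (sdelta g Phi l) j i Ux).
by generalize_values; lra.
Qed.

(** The only bracket term that survives is the product of xi with the bracket of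
    two vectors of SM; it is the part Phi^2 omega of K. *)
Lemma koszul_xi i l x : U x ->
  gprod g (nabla g (xi R) (sdelta g Phi i)) (sdelta g Phi l) x = Klow g Phi l i x.
Proof.
move=> Ux; have sxi : smooth_field U (xi R) := smooth_dcoord ord0.
have := koszul U_open g_smooth g_sym g_unit sxi
  (smooth_field_sdelta i) (smooth_field_sdelta l) Ux.
have E X p : vder X (gprod g (xi R) (sdelta g Phi p)) x = 0.
  apply: etrans (vder_cst X 0 x); apply: (vder_ext U_open) => // y /set_mem Uy.
  exact: gprod_xi_sdelta.
move: (gprod_bracket_xi i l Ux) (gprod_bracket_xi l i Ux).
move: (gprod_bracket_sdelta i l (xi R) Ux) (g_xi Ux).
move: (E (sdelta g Phi i) l) (E (sdelta g Phi l) i).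
move: (vder_gprod_sdelta (xi R) i l Ux) (omegaC i l x).
rewrite /Klow /Theta -vder_dcoord -/(xi R).
by generalize_values => Hv -> E1 E2 + Hx; rewrite Hx; lra.
Qed.

(** [spatial_conn a l h] is the component on delta/delta x^l of the derivative of
    delta/delta x^h along the vector of index a of the adapted frame. *)
Definition spatial_conn a l h : scalar_field R :=
  if unlift ord0 a is Some j then Gammabar g Phi h l j else Kmix g Phi l h.

Lemma spatial_conn_sp j l h : spatial_conn (sp j) l h = Gammabar g Phi h l j.
Proof. by rewrite /spatial_conn liftK. Qed.

Lemma spatial_conn_xi l h : spatial_conn ord0 l h = Kmix g Phi l h.
Proof. by rewrite /spatial_conn unlift_none. Qed.

Lemma spatial_conn_koszul a l h x : U x -> spatial_conn a l h x =
  \sum_m invmx (gbar g Phi x) l m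
    * gprod g (nabla g (e a) (sdelta g Phi h)) (sdelta g Phi m) x.
Proof.
move=> Ux; case: (unliftP ord0 a) => [j|] ->.
  rewrite spatial_conn_sp frame_sp /Gammabar big_distrr; apply: eq_bigr => m _ /=.
  by rewrite koszul_sdelta // mulrCA.
rewrite spatial_conn_xi frame_xi; apply: eq_bigr => m _.
by rewrite koszul_xi.
Qed.

Lemma scomp_Sproj V l x : scomp (Sproj g V) l x = V x 0 (sp l).
Proof.
by rewrite /scomp /Sproj /xi /dcoord !mxE /= mulr0 subr0.
Qed.

Lemma Sproj_combination V x : U x ->
  Sproj g V x = \sum_l V x 0 (sp l) *: sdelta g Phi l x.
Proof.
move=> Ux; rewrite (Sproj_expansion _ (Phi_neq0 Ux) (g_xi Ux)).
by apply: eq_bigr => l _; rewrite scomp_Sproj.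
Qed.

Lemma Sproj_sdelta i x : U x -> Sproj g (sdelta g Phi i) x = sdelta g Phi i x.
Proof. by move=> Ux; rewrite /Sproj gprod_sdelta_xi // mul0r scale0r subr0. Qed.

Lemma gprod_Sproj V i x : U x ->
  gprod g (Sproj g V) (sdelta g Phi i) x = gprod g V (sdelta g Phi i) x.
Proof.
move=> Ux; rewrite gprodBl.
rewrite (gprodZl g (fun y => gprod g V (xi R) y / gprod g (xi R) (xi R) y)).
by rewrite gprod_xi_sdelta // mulr0 subr0.
Qed.

(** The components of the Levi-Civita derivative on the delta/delta x^l are found
    by solving the linear system whose right-hand side is given by the Koszul
    formula and whose matrix is that of the spatial metric. *)
Lemma nabla_sdelta a l h x : U x ->
  nabla g (e a) (sdelta g Phi h) x 0 (sp l) = spatial_conn a l h x.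
Proof.
move=> Ux; set W := nabla _ _ _.
have low m : gprod g W (sdelta g Phi m) x
    = \sum_k W x 0 (sp k) * gbar g Phi x k m.
  rewrite -gprod_Sproj //.
  rewrite (@gprod_at _ _ _ (fun y => \sum_k W x 0 (sp k) *: sdelta g Phi k y) _
    (sdelta g Phi m)) ?Sproj_combination //.
  rewrite gprod_suml; apply: eq_bigr => k _.
  by rewrite (gprodZl g (fun=> W x 0 (sp k))) gbarE.
rewrite spatial_conn_koszul // -/W.
under eq_bigr => m _ do rewrite low big_distrr /=.
rewrite exchange_big /=.
have E k : \sum_m invmx (gbar g Phi x) l m * (W x 0 (sp k) * gbar g Phi x k m)
         = W x 0 (sp k) * (l == k)%:R.
  transitivity (W x 0 (sp k) * (invmx (gbar g Phi x) *m gbar g Phi x) l k).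
    rewrite [X in _ = _ * X]mxE [RHS]big_distrr; apply: eq_bigr => m _ /=.
    by rewrite (gbarC k m Ux) mulrCA.
  by rewrite mulVmx ?gbar_unit // [X in _ * X = _]mxE.
under eq_bigr => k _ do rewrite E.
rewrite (bigD1 l) //= big1 ?addr0 ?eqxx ?mulr1 // => k kl.
by rewrite eq_sym (negPf kl) mulr0.
Qed.

Lemma smooth_invmx_gbar i j : smooth_on U (fun x => invmx (gbar g Phi x) i j).
Proof. exact: smooth_invmx smooth_gbar gbar_unit i j. Qed.

Lemma smooth_spatial_conn a l h : smooth_on U (spatial_conn a l h).
Proof.
have sc := smooth_cst U_open (2^-1 : R).
have sD i f : smooth_on U f -> smooth_on U (vder (sdelta g Phi i) f).
  exact: smooth_vder (smooth_field_sdelta i).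
case: (unliftP ord0 a) => [j|] ->.
  rewrite spatial_conn_sp; apply: (smoothM U_open sc).
  apply: (smooth_sum U_open) => m; apply: (smoothM U_open (smooth_invmx_gbar l m)).
  exact (smoothB U_open (smoothD U_open (sD _ _ (smooth_gbar _ _))
    (sD _ _ (smooth_gbar _ _))) (sD _ _ (smooth_gbar _ _))).
rewrite spatial_conn_xi; apply: (smooth_sum U_open) => m.
apply: (smoothM U_open (smooth_invmx_gbar l m)).
have sTheta : smooth_on U (Theta g Phi m h).
  exact: (smoothM U_open sc (smooth_pd ord0 (smooth_gbar m h))).
have somega : smooth_on U (omega g Phi m h).
  exact: (smoothM U_open sc (smoothB U_open (sD _ _ (smooth_Acoef h))
    (sD _ _ (smooth_Acoef m)))).
apply: (smoothD U_open sTheta).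
apply: (smooth_ext U_open) (smoothM U_open (smoothM U_open Phi_smooth Phi_smooth) somega).
by move=> x _; rewrite expr2.
Qed.

(** Leibniz rule; the projection leaves the components on the delta/delta x^l
    unchanged, as it only subtracts a multiple of xi. *)
Lemma scomp_nablabar_combination a (f : 'I_3 -> scalar_field R) V l x :
    (forall m, smooth_on U (f m)) ->
    (forall y, U y -> V y = \sum_m f m y *: sdelta g Phi m y) -> U x ->
  scomp (nablabar g (e a) V) l x
  = vder (e a) (f l) x + \sum_m spatial_conn a l m x * f m x.
Proof.
move=> sf VE Ux; rewrite /nablabar scomp_Sproj (nabla_ext g U_open _ VE Ux).
rewrite (nabla_sum g U_open _ sf (fun m => @smooth_field_sdelta m) Ux) summxE.
under eq_bigr => m _ do
  rewrite mxE [in X in X + _]mxE [in X in _ + X]mxE scomp_sdelta nabla_sdelta //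
    [_ * spatial_conn _ _ _ _]mulrC.
rewrite big_split; congr (_ + _) => /=.
rewrite (bigD1 l) //= big1 ?addr0 ?eqxx ?mulr1 // => m ml.
by rewrite eq_sym (negPf ml) mulr0.
Qed.

Lemma nablabar_Sproj_sdelta a h x : U x ->
  nablabar g (e a) (Sproj g (sdelta g Phi h)) x
  = \sum_m spatial_conn a m h x *: sdelta g Phi m x.
Proof.
move=> Ux; rewrite /nablabar Sproj_combination //; apply: eq_bigr => m _.
rewrite (nabla_ext g U_open _ (Y' := sdelta g Phi h)) ?nabla_sdelta // => y Uy.
exact: Sproj_sdelta.
Qed.

(** Two applications of [scomp_nablabar_combination]; the bracket being a multiple
    of xi, the last term of the curvature gives the connection along xi. *)
Lemma scomp_Rbar a b l h x : U x ->
  scomp (Rbar g (e a) (e b) (sdelta g Phi h)) l x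
  = curv threading_coef spatial_conn a b l h x.
Proof.
move=> Ux.
have entry (u v w : 'rV[R]_4) :
    (u - v - w) 0 (sp l) = u 0 (sp l) - v 0 (sp l) - w 0 (sp l) by rewrite !mxE.
have E p q := scomp_nablabar_combination p l (fun m => smooth_spatial_conn q m h)
  (fun y Uy => nablabar_Sproj_sdelta q h Uy) Ux.
have T : nablabar g (bracket (e a) (e b)) (Sproj g (sdelta g Phi h)) x 0 (sp l)
    = str a b x * spatial_conn ord0 l h x.
  apply: etrans (scomp_Sproj _ _ _) _.
  rewrite (nabla_ext g U_open _ (@Sproj_sdelta h) Ux).
  rewrite (@nabla_at _ _ _ (e ord0) (str a b x)); last first.
    by rewrite frame_xi; apply: (bracket_frame U_open sA).
  by rewrite mxE nabla_sdelta.
apply: etrans (entry _ _ _) _.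
apply: etrans (congr2 (fun r s => r - s) (congr2 (fun r s => r - s) (E a b) (E b a)) T) _.
rewrite /curv [X in _ = _ + X - _]sumrB; generalize_values.
by move: (\sum_m _) (\sum_m _) => S1 S2; ring.
Qed.

(** * The Bianchi identities *)

Local Notation F a b := (curv threading_coef spatial_conn a b).
Local Notation DF c a b := (cov_curv threading_coef spatial_conn c a b).

Lemma Rs_curv l h i j x : U x -> Rs g Phi l h i j x = F (sp j) (sp i) l h x.
Proof.
move=> Ux; apply: etrans (scomp_Rbar (sp j) (sp i) l h Ux).
by rewrite !frame_sp.
Qed.

Lemma R0_curv l h i x : U x -> R0 g Phi l h i x = F (sp i) ord0 l h x.
Proof.
move=> Ux; apply: etrans (scomp_Rbar (sp i) ord0 l h Ux).
by rewrite frame_sp frame_xi.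
Qed.

Lemma RsC l h i j x : U x -> Rs g Phi l h j i x = - Rs g Phi l h i j x.
Proof. by move=> Ux; rewrite !Rs_curv // curvC. Qed.

(** The brackets of the delta/delta x^i have no component along SM, so that the
    absence of torsion along SM is a symmetry of the coefficients. *)
Lemma spatial_conn_sym i j l x : U x ->
  spatial_conn (sp j) l i x = spatial_conn (sp i) l j x.
Proof.
move=> Ux; rewrite !spatial_conn_sp /Gammabar; congr (_ * _).
apply: eq_bigr => m _; congr (_ * _); congr (_ - _); first exact: addrC.
by apply: (vder_ext U_open) => // y /set_mem; apply: gbarC.
Qed.

Lemma cov_curvC a b c l h x : U x -> DF c b a l h x = - DF c a b l h x.
Proof.
move=> Ux; have sF := smooth_curv U_open sA smooth_spatial_conn.
rewrite /cov_curv opprD; congr (_ + _).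
  apply: etrans (vderN U_open _ (sF a b l h) Ux).
  by apply: (vder_ext U_open) => // y _; rewrite curvC.
rewrite -sumrN; apply: eq_bigr => m _; rewrite !(curvC _ _ a b).
by rewrite mulrN mulNr opprD.
Qed.

Lemma cov13_Rs c l h i j x : U x ->
  cov13 (e c) (spatial_conn c) (Rs g Phi) l h i j x
  = DF c (sp j) (sp i) l h x
    - \sum_m Rs g Phi l h m j x * spatial_conn c m i x
    - \sum_m Rs g Phi l h i m x * spatial_conn c m j x.
Proof.
move=> Ux; rewrite /cov13 /cov_curv; congr (_ - _ - _).
rewrite [X in _ = _ + X]sumrB addrA; congr (_ + _ - _).
- by apply: (vder_ext U_open) => // y /set_mem; apply: Rs_curv.
- by apply: eq_bigr => m _; rewrite Rs_curv // mulrC.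
- by apply: eq_bigr => m _; rewrite Rs_curv.
Qed.

Lemma cov12_R0 c l h i x : U x ->
  cov12 (e c) (spatial_conn c) (R0 g Phi) l h i x
  = DF c (sp i) ord0 l h x - \sum_m R0 g Phi l h m x * spatial_conn c m i x.
Proof.
move=> Ux; rewrite /cov12 /cov_curv; congr (_ - _).
rewrite [X in _ = _ + X]sumrB addrA; congr (_ + _ - _).
- by apply: (vder_ext U_open) => // y /set_mem; apply: R0_curv.
- by apply: eq_bigr => m _; rewrite R0_curv // mulrC.
- by apply: eq_bigr => m _; rewrite R0_curv.
Qed.

Lemma spatial_conn_spE k : (fun p q => Gammabar g Phi q p k) = spatial_conn (sp k).
Proof. by apply/funext => p; apply/funext => q; rewrite spatial_conn_sp. Qed.

Lemma spatial_conn_xiE : Kmix g Phi = spatial_conn ord0.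
Proof. by apply/funext => p; apply/funext => q; rewrite spatial_conn_xi. Qed.

(** The last two sums come from the derivative of the frame vectors in the two
    arguments i, j of the curvature; [cov_curv] contains the rest. *)
Lemma Rs_barE l h i j k x : U x -> Rs_bar g Phi l h i j k x =
  DF (sp k) (sp j) (sp i) l h x
  - \sum_m Rs g Phi l h m j x * spatial_conn (sp k) m i x
  + \sum_m Rs g Phi l h m i x * spatial_conn (sp k) m j x.
Proof.
move=> Ux; rewrite /Rs_bar spatial_conn_spE -frame_sp cov13_Rs //.
congr (_ + _); rewrite -sumrN; apply: eq_bigr => m _.
by rewrite (RsC l h m i Ux) mulNr opprK.
Qed.

Lemma Rs_bar0E l h i j x : U x -> Rs_bar0 g Phi l h i j x =
  DF ord0 (sp j) (sp i) l h x
  + \sum_m Rs g Phi l h j m x * Kmix g Phi m i x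
  - \sum_m Rs g Phi l h i m x * Kmix g Phi m j x.
Proof.
move=> Ux; rewrite /Rs_bar0 spatial_conn_xiE -frame_xi cov13_Rs //.
congr (_ + _ - _); rewrite -sumrN; apply: eq_bigr => m _.
by rewrite (RsC l h j m Ux) mulNr opprK.
Qed.

(** The index 0 is not a tensor index, so only i contributes a sum besides
    [cov_curv]. *)
Lemma R0_barE l h i k x : U x -> R0_bar g Phi l h i k x =
  DF (sp k) (sp i) ord0 l h x
  - \sum_m R0 g Phi l h m x * spatial_conn (sp k) m i x.
Proof. by move=> Ux; rewrite /R0_bar spatial_conn_spE -frame_sp cov12_R0. Qed.

(** Every term of the curvature made of the spatial coefficients alone is symmetric
    in two of the cyclically permuted indices and occurs with both signs; only the
    bracket terms in omega and K survive. *)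
Lemma first_bianchi h i j k x : U x ->
  cyc_sum (fun i j k =>
    Rs g Phi h i j k x + 2 * Kmix g Phi h i x * omega g Phi j k x) i j k = 0.
Proof.
move=> Ux.
pose P k j i := vder (e (sp k)) (spatial_conn (sp j) h i) x.
pose Q k j i := \sum_m spatial_conn (sp k) h m x * spatial_conn (sp j) m i x.
have PC p q r : P p q r = P p r q.
  by apply: (vder_ext U_open) => // y /set_mem; apply: spatial_conn_sym.
have QC p q r : Q p q r = Q p r q.
  by apply: eq_bigr => m _; rewrite (spatial_conn_sym r q m Ux).
have RE p q r : Rs g Phi h p q r x = P r q p - P q r p + (Q r q p - Q q r p)
    + 2 * omega g Phi r q x * Kmix g Phi h p x.
  rewrite Rs_curv // /curv structure_coef_sp spatial_conn_xi mulNr opprK.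
  by congr (_ + _ + _); rewrite sumrB.
clearbody P Q; rewrite /cyc_sum !RE (omegaC j k) (omegaC k i) (omegaC i j).
rewrite (PC k j) (PC j i) (PC i k) (QC k j) (QC j i) (QC i k).
by generalize_values; ring.
Qed.

(** [bianchi] for three spatial vectors: [omega] enters through their structure
    coefficients, and the sums of [Rs_barE] cancel by symmetry. *)
Lemma second_bianchi h l i j k x : U x ->
  cyc_sum (fun i j k =>
    Rs_bar g Phi l h i j k x + 2 * R0 g Phi l h i x * omega g Phi j k x) i j k = 0.
Proof.
move=> Ux.
pose T p q r := \sum_m Rs g Phi l h m p x * spatial_conn (sp q) m r x.
have TC p q r : T p q r = T p r q.
  by apply: eq_bigr => m _; rewrite (spatial_conn_sym r q m Ux).
pose D p q r := DF (sp p) (sp q) (sp r) l h x.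
have RE p q r : Rs_bar g Phi l h p q r x = D r q p - T q r p + T p r q.
  exact: Rs_barE.
have B : (D k j i - 2 * omega g Phi k j x * R0 g Phi l h i x)
    + (D j i k - 2 * omega g Phi j i x * R0 g Phi l h k x)
    + (D i k j - 2 * omega g Phi i k x * R0 g Phi l h j x) = 0.
  have E p q r : 2 * omega g Phi p q x * R0 g Phi l h r x
      = str (sp p) (sp q) x * F ord0 (sp r) l h x.
    by rewrite (R0_curv _ _ _ Ux) structure_coef_sp (curvC _ _ ord0) mulNr mulrN.
  apply: etrans (bianchi U_open sA threading_coef0 smooth_spatial_conn
    (sp k) (sp j) (sp i) l h Ux).
  by congr ((_ - _) + (_ - _) + (_ - _)); apply: E.
clearbody D T; move: B; rewrite /cyc_sum !RE.
rewrite (omegaC j k) (omegaC k i) (omegaC i j) (TC j k i) (TC i k j) (TC k i j).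
by generalize_values; lra.
Qed.

(** [bianchi] for d/dx^0 and two spatial vectors: the coefficients a_i are the
    structure coefficients of d/dx^0 with them, the sums with K of [Rs_bar0E]
    cancel those of the identity, and the sums of [R0_barE] cancel by symmetry. *)
Lemma third_bianchi h l i j x : U x ->
  Rs_bar0 g Phi l h i j x + R0_bar g Phi l h i j x
  - R0_bar g Phi l h j i x
  + \sum_k Rs g Phi l h i k x * Kmix g Phi k j x
  - \sum_k Rs g Phi l h j k x * Kmix g Phi k i x
  + acoef g Phi j x * R0 g Phi l h i x
  - acoef g Phi i x * R0 g Phi l h j x
  = 0.
Proof.
move=> Ux.
pose T p q := \sum_m R0 g Phi l h m x * spatial_conn (sp q) m p x.
have TC p q : T p q = T q p.
  by apply: eq_bigr => m _; rewrite (spatial_conn_sym p q m Ux).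
pose S p q := \sum_m Rs g Phi l h p m x * Kmix g Phi m q x.
pose D p q := DF (sp q) (sp p) ord0 l h x.
pose D0 := DF ord0 (sp j) (sp i) l h x.
have RE : Rs_bar0 g Phi l h i j x = D0 + S j i - S i j by exact: Rs_bar0E.
have R0E p q : R0_bar g Phi l h p q x = D p q - T p q by exact: R0_barE.
have B : D0 + D i j - D j i + acoef g Phi j x * R0 g Phi l h i x
    - acoef g Phi i x * R0 g Phi l h j x = 0.
  have F0 : F ord0 ord0 l h x = 0.
    have := curvC threading_coef spatial_conn ord0 ord0 l h x.
    by move: (F ord0 ord0 l h x) => r; lra.
  have := bianchi U_open sA threading_coef0 smooth_spatial_conn
    ord0 (sp j) (sp i) l h Ux.
  rewrite -/D0 -/(D i j) (cov_curvC (sp j) ord0 (sp i) l h Ux) -/(D j i) F0.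
  rewrite (structure_coefC _ ord0 (sp i)) !structure_coef_xi.
  rewrite (curvC _ _ (sp i) ord0) (curvC _ _ (sp j) ord0) -!R0_curv //.
  by generalize_values; lra.
suff : D0 + S j i - S i j + (D i j - T i j) - (D j i - T j i) + S i j - S j i
    + acoef g Phi j x * R0 g Phi l h i x - acoef g Phi i x * R0 g Phi l h j x = 0.
  by rewrite RE !R0E.
clearbody D0 D S T; rewrite (TC j i).
by move: B; generalize_values; lra.
Qed.

End SpatialConnection.

Lemma minkowski_unit (R : realType) : Defs.minkowski R \in unitmx.
Proof.
rewrite unitmxE unitfE det_diag; apply/prodf_neq0 => a _; rewrite mxE.
by case: ifP; rewrite ?oppr_eq0 oner_eq0.
Qed.

Lemma lorentzian_unit (R : realType) (G : 'M[R]_4) : lorentzian G -> G \in unitmx.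
Proof.
move=> [_ [P [_ PGP]]]; have := minkowski_unit R.
by rewrite -PGP !unitmx_mul => /andP[/andP[]].
Qed.

(* In the second identity the term in omega is 2 R_h^l_0i omega_jk, without    *)
(* covariant derivative: with R_h^l_0i|k omega_jk in its place the identity    *)
(* fails, for instance for                                                     *)
(* g = -(dx^0 + x^1 x^3 dx^2)^2 + (dx^1)^2 + (dx^2)^2 + (dx^3)^2 and Phi = 1.  *)
Theorem mainTheorem5 (R : realType) (U : set 'rV[R]_4)
    (g : 'rV[R]_4 -> 'M[R]_4) (Phi : 'rV[R]_4 -> R)
    (U_open : open U)
    (g_smooth : forall a b : 'I_4, smooth_on U (fun x => g x a b))
    (g_lorentz : forall x, U x -> lorentzian (g x))
    (Phi_smooth : smooth_on U Phi)
    (Phi_neq0 : forall x, U x -> Phi x != 0)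
    (g_xi : forall x, U x -> gprod g (xi R) (xi R) x = - (Phi x) ^+ 2) :
  [/\ forall (x : 'rV[R]_4) (h i j k : 'I_3), U x ->
        cyc_sum (fun i j k =>
          Rs g Phi h i j k x + 2 * Kmix g Phi h i x * omega g Phi j k x) i j k
        = 0,
      forall (x : 'rV[R]_4) (h l i j k : 'I_3), U x ->
        cyc_sum (fun i j k =>
          Rs_bar g Phi l h i j k x + 2 * R0 g Phi l h i x * omega g Phi j k x)
          i j k
        = 0
    & forall (x : 'rV[R]_4) (h l i j : 'I_3), U x ->
        Rs_bar0 g Phi l h i j x + R0_bar g Phi l h i j x
        - R0_bar g Phi l h j i x
        + \sum_k Rs g Phi l h i k x * Kmix g Phi k j x
        - \sum_k Rs g Phi l h j k x * Kmix g Phi k i x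
        + acoef g Phi j x * R0 g Phi l h i x
        - acoef g Phi i x * R0 g Phi l h j x
        = 0].
Proof.
have g_sym x : U x -> (g x)^T = g x by move=> /g_lorentz[].
have g_unit x : U x -> g x \in unitmx by move=> /g_lorentz; exact: lorentzian_unit.
split=> [x h i j k Ux|x h l i j k Ux|x h l i j Ux].
- exact: (first_bianchi U_open g_smooth g_sym g_unit Phi_smooth Phi_neq0 g_xi).
- exact: (second_bianchi U_open g_smooth g_sym g_unit Phi_smooth Phi_neq0 g_xi).
- exact: (third_bianchi U_open g_smooth g_sym g_unit Phi_smooth Phi_neq0 g_xi).
Qed.
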